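(* Let $(M,\Omega,\Gamma,Z,h)$ be a Joyce structure, $\mathcal{A}=h+\epsilon^{-1}v$, $\mathcal{A}^{\mathrm{st}}=\mathcal{H}+\epsilon^{-1}v$, and let $\dot g\in\mathrm{Lie}(\widehat{\mathcal G})$ be the unique element with $e^{\mathcal L_{\dot g}}\mathcal{A}^{\mathrm{st}}=\mathcal{A}$ and $\dot g|_M=0$. Let $(Z^i)$ be $\nabla$-flat Darboux coordinates on an open set $U\subset M$, $(Z^i,\theta^i)$ the induced coordinates on $\pi^{-1}(U)\subset TM$, $x^{i,\mathrm{st}}=\theta^i-\epsilon^{-1}Z^i$ and $$x^i=e^{\dot g}x^{i,\mathrm{st}}=\sum_{k\ge0}\frac{\dot g^k(x^{i,\mathrm{st}})}{k!}.$$ Then $x^i-x^{i,\mathrm{st}}\in\epsilon\cdot\mathcal{O}_{TM}(\pi^{-1}(U))[[\epsilon]]$, and for every point $p_0\in U\subset M$ of the zero section there is a polydisc $B_r=B_r(p_0)\subset\pi^{-1}(U)$ (in the coordinates $(Z^i,\theta^i)$, centred at $p_0$) such that the Borel transform $\mathcal{B}[x^i-x^{i,\mathrm{st}}](\xi)$ converges in a neighbourhood of $\xi=0$, uniformly in $p\in B_r$.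
   Context: All objects and morphisms are holomorphic. $\pi:TM\to M$ is the tangent bundle projection and $V_\pi=\mathrm{Ker}(\pi_* )\subset T(TM)$ the vertical bundle. $v:\pi^*(TM)\to V_\pi$ is the canonical identification: in coordinates $(Z^i,\theta^i)$ on $TM$ induced by coordinates $(Z^i)$ on $M$, $v_{\partial_{Z^i}}=\partial_{\theta^i}$. An (Ehresmann) connection on $\pi$ is a bundle map $h:\pi^*(TM)\to T(TM)$ with $\pi_*\circ h=\mathrm{Id}$; for a local vector field $X$ on $M$, $h_X=h(X)$ denotes the lifted vector field on $TM$. It is flat if its image distribution is involutive, equivalently $[h_X,h_Y]=h_{[X,Y]}$ for all local vector fields $X,Y$ on $M$. For a holomorphic symplectic form $\Omega$ on $M$, $\Omega^v$ is the fibrewise symplectic form on $V_\pi$ with $\Omega^v(v_X,v_Y)=\Omega(X,Y)$; a connection is symplectic if its parallel transport maps between open subsets of fibres of $\pi$ preserve $\Omega^v$. A pre-Joyce structure on $(M,\Omega)$ is a connection $h$ on $\pi$ such that $\mathcal{A}^\epsilon=h+\epsilon^{-1}v$ is flat and symplectic for each $\epsilon\in\mathbb{C}^*$. A period structure on $M$ is a pair $(\Gamma,Z)$ where $\Gamma\to M$ is a bundle of full lattices in $TM$ ($\Gamma_p\subset T_pM$ a discrete finitely generated subgroup with $\Gamma_p\otimes_{\mathbb Z}\mathbb{C}=T_pM$), and $Z$ is a holomorphic vector field on $M$ with $\nabla Z=\mathrm{Id}_{TM}$, where $\nabla$ is the flat linear connection on $TM$ for which local sections of $\Gamma$ are flat.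 A Joyce structure $(M,\Omega,\Gamma,Z,h)$ is a pre-Joyce structure $(\Omega,h)$ together with a period structure $(\Gamma,Z)$ such that: (J1) $(2\pi\mathrm{i})^{-1}\Omega^{-1}$ takes integral values on the dual lattices $\Gamma^*\subset T^*M$; (J2) $h$ is invariant under translations by $(2\pi \mathrm{i})\Gamma\subset TM$; (J3) if $E$ is the $\nabla$-horizontal lift of $Z$ to $TM$, then $h([Z,X])=[E,h(X)]$ for every vector field $X$ on $M$; (J4) $h$ is invariant under the involution of $TM$ acting by $-1$ on the fibres of $\pi$. $\mathcal{H}$ is the Ehresmann connection on $\pi$ induced by $\nabla$. $\nabla$-flat Darboux coordinates $(Z^i)$ are local coordinates with $\nabla(\mathrm{d}Z^i)=0$ and $\Omega$ having constant coefficients; in the induced coordinates $\mathcal{H}_{\partial_{Z^i}}=\partial_{Z^i}$. Formal objects: $\epsilon$ is a formal variable. $\mathrm{Lie}(\widehat{\mathcal G})$ is the set of series $\dot g=\sum_{k\ge1}\dot g_k\epsilon^k$ with each $\dot g_k$ a global vertical vector field on $TM$ (section of $V_\pi\to TM$). For a formal relative connection $\mathcal{B}=\epsilon^{-1}v+h'$, $(e^{\mathcal{L}_{\dot g}}\mathcal{B})_X=\sum_{k\ge0}\frac{1}{k!}\mathcal{L}_{\dot g}^k(\mathcal{B}_X)$ for local vector fields $X$ on $M$, with $\mathcal{L}_{\dot g}Y=[\dot g,Y]$. It is a fact that exactly one such $\dot g$ with $e^{\mathcal L_{\dot g}}\mathcal{A}^{\mathrm{st}}=\mathcal{A}$ and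 $\dot g|_M=0$ exists. $\dot g$ acts on formal series of functions as a derivation, linearly in $\epsilon$. The Borel transform of $f=\sum_{k\ge1}f_k\epsilon^k$ is $\mathcal{B}[f](\xi)=\sum_{k\ge1}\frac{f_k}{(k-1)!}\xi^{k-1}$. A polydisc $B_r(p_0)$ is a product of discs of the same radius $r$ centred at the coordinates of $p_0$. *)

(* Defs.v *)
(* Complex numbers are R[i] over R : realType; holomorphic
   means complex (Frechet) differentiable on an open subset of a normed C-space.

   Objects on a complex manifold M (and on TM) are given by their components in
   every chart of the maximal atlas of M, subject to the usual transformation
   laws.  A chart a with image img a in C^n induces a chart of TM with image
   img a * C^n, whose points are written w = (z, th); the components of a tangent
   vector to TM at such a point form again a pair, of a d/dz part and a d/dth
   part.  A local vector field on M (or a local section of a bundle) defined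
   inside the domain of a chart a is a holomorphic map on an open O in img a. *)
From HB Require Import structures.
From mathcomp Require Import all_boot all_order all_algebra.
From mathcomp Require Import complex.
From mathcomp Require Import all_classical all_reals all_analysis.

Set Implicit Arguments.
Unset Strict Implicit.
Unset Printing Implicit Defensive.

Import Order.TTheory GRing.Theory Num.Theory.
Import numFieldNormedType.Exports.

Local Open Scope classical_set_scope.
Local Open Scope complex_scope.
Local Open Scope ring_scope.

(* The norm topology on R[i]; MathComp-Analysis only declares it on R[i]^o. *)
HB.instance Definition _ (R : realType) := NormedModule.copy (R[i]) (R[i]^o).

Notation CV R n := ('rV[R[i]]_n).
Notation TCV R n := ('rV[R[i]]_n * 'rV[R[i]]_n)%type.

Definition holo (R : realType) (V W : normedModType R[i]) (A : set V)
    (f : V -> W) : Prop :=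
  forall x, A x -> differentiable f x.

Definition bracket (R : realType) (V : normedModType R[i]) (X Y : V -> V) : V -> V :=
  fun x => 'd Y x (X x) - 'd X x (Y x).

Definition deriv_along (R : realType) (V W : normedModType R[i]) (X : V -> V)
    (f : V -> W) : V -> W :=
  fun x => 'd f x (X x).

(* Derivative at t of a curve parametrized by the real interval [0, 1]
   (one-sided at the end points). *)
Definition rderive01 (R : realType) (W : normedModType R[i]) (c : R -> W) (t : R)
    (d : W) : Prop :=
  (fun s : R => ((s - t)^-1)%:C *: (c s - c t))
    @ within [set s : R | 0 <= s <= 1] (dnbhs t) --> d.

Record chart (R : realType) (n : nat) (T : Type) := Chart {
  cdom : set T;
  cmap : T -> CV R n;
  cinv : CV R n -> T
}.

Definition img (R : realType) (n : nat) (T : Type) (a : chart R n T)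
  : set (CV R n) := cmap a @` cdom a.

Definition is_chart (R : realType) (n : nat) (T : topologicalType)
    (a : chart R n T) : Prop :=
  [/\ open (cdom a), open (img a),
      forall p, cdom a p -> cinv a (cmap a p) = p,
      forall p, cdom a p -> {for p, continuous (cmap a)}
    & forall z, img a z -> {for z, continuous (cinv a)}].

Definition trans (R : realType) (n : nat) (T : Type) (a b : chart R n T)
  : CV R n -> CV R n := fun z => cmap b (cinv a z).

Definition overlap (R : realType) (n : nat) (T : Type) (a b : chart R n T)
  : set (CV R n) := [set z | img a z /\ cdom b (cinv a z)].

Record complex_manifold (R : realType) (n : nat) := ComplexManifold {
  carrier :> topologicalType;
  atlas : set (chart R n carrier);
  manifold_hausdorff : hausdorff_space carrier;
  manifold_second_countable : @second_countable carrier;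
  atlas_chart : forall a, atlas a -> is_chart a;
  atlas_cover : forall p : carrier, exists2 a, atlas a & cdom a p;
  atlas_compatible : forall a b, atlas a -> atlas b ->
    holo (overlap a b) (trans a b);
  atlas_maximal : forall c, is_chart c ->
    (forall a, atlas a ->
       holo (overlap a c) (trans a c) /\ holo (overlap c a) (trans c a)) ->
    atlas c
}.

Section Objects.
Context (R : realType) (n : nat) (M : complex_manifold R n).
Notation C := R[i].
Notation E := (CV R n).
Notation TE := (TCV R n).
Notation Ch := (chart R n M).

Definition Timg (a : Ch) : set TE := [set w | img a w.1].

Definition Ttrans (a b : Ch) : TE -> TE :=
  fun w => (trans a b w.1, 'd (trans a b) (w.1) (w.2)).

Definition vector_field (X : Ch -> E -> E) : Prop :=
  (forall a, atlas a -> holo (img a) (X a)) /\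
  (forall a b z, atlas a -> atlas b -> overlap a b z ->
     X b (trans a b z) = 'd (trans a b) z (X a z)).

Definition Tvector_field (Y : Ch -> TE -> TE) : Prop :=
  (forall a, atlas a -> holo (Timg a) (Y a)) /\
  (forall a b w, atlas a -> atlas b -> overlap a b w.1 ->
     Y b (Ttrans a b w) = 'd (Ttrans a b) w (Y a w)).

Definition vertical (Y : Ch -> TE -> TE) : Prop :=
  forall a w, atlas a -> Timg a w -> (Y a w).1 = 0.

Definition local_field (a : Ch) (O : set E) (X : E -> E) : Prop :=
  [/\ open O, O `<=` img a & holo O X].

Definition mxform (G : 'M[C]_n) (u v : E) : C := (u *m G *m v^T) 0 0.

Definition symplectic_form (Om : Ch -> E -> 'M[C]_n) : Prop :=
  [/\ forall a, atlas a -> holo (img a) (Om a),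
      forall a b z, atlas a -> atlas b -> overlap a b z -> forall u v,
        mxform (Om b (trans a b z)) ('d (trans a b) z u) ('d (trans a b) z v)
        = mxform (Om a z) u v,
      forall a z, atlas a -> img a z -> (Om a z)^T = - Om a z,
      forall a z, atlas a -> img a z -> Om a z \in unitmx
    & forall a z, atlas a -> img a z -> forall u v w,
        mxform ('d (Om a) z u) v w + mxform ('d (Om a) z v) w u
        + mxform ('d (Om a) z w) u v = 0].

(* h a w X is the lift to the point w of TM of the tangent vector X of M at
   the base point w.1, all in components in the chart a. *)
Definition connection (h : Ch -> TE -> E -> TE) : Prop :=
  [/\ forall a w, atlas a -> Timg a w -> linear (h a w),
      forall a w X, atlas a -> Timg a w -> (h a w X).1 = X,
      forall a X, atlas a -> holo (Timg a) (fun w => h a w X)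
    & forall a b w X, atlas a -> atlas b -> overlap a b w.1 ->
        h b (Ttrans a b w) ('d (trans a b) (w.1) X) = 'd (Ttrans a b) w (h a w X)].

Definition hlift (k : TE -> E -> TE) (X : E -> E) : TE -> TE :=
  fun w => k w (X w.1).

Definition vert (w : TE) (X : E) : TE := (0, X).

Definition pencil (h : Ch -> TE -> E -> TE) (eps : C) : Ch -> TE -> E -> TE :=
  fun a w X => h a w X + eps^-1 *: vert w X.

Definition flat_connection (h : Ch -> TE -> E -> TE) : Prop :=
  forall a O X Y, atlas a -> local_field a O X -> local_field a O Y ->
  forall w, O w.1 ->
    bracket (hlift (h a) X) (hlift (h a) Y) w = hlift (h a) (bracket X Y) w.

Definition C1_path (gam : R -> M) : Prop :=
  {within [set t : R | 0 <= t <= 1], continuous gam} /\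
  exists vel : Ch -> R -> E, forall a t, atlas a -> 0 <= t <= 1 -> cdom a (gam t) ->
    rderive01 (cmap a \o gam) t (vel a t) /\
    vel a @ within [set s : R | 0 <= s <= 1] (nbhs t) --> vel a t.

(* th a t is the fibre component in the chart a, at time t, of a curve in TM
   lying over gam. *)
Definition horizontal_lift (h : Ch -> TE -> E -> TE) (gam : R -> M)
    (th : Ch -> R -> E) : Prop :=
  forall a t, atlas a -> 0 <= t <= 1 -> cdom a (gam t) ->
    (forall b, atlas b -> cdom b (gam t) ->
       th b t = 'd (trans a b) (cmap a (gam t)) (th a t)) /\
    exists X, rderive01 (fun s => (cmap a (gam s), th a s)) t
                        (h a (cmap a (gam t), th a t) X).

(* P : V -> C^n is the parallel transport along gam, from an open subset V of
   the fibre over gam 0 (read in the chart a0) to the fibre over gam 1 (read in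
   the chart a1). *)
Definition parallel_transport (h : Ch -> TE -> E -> TE) (gam : R -> M)
    (a0 a1 : Ch) (V : set E) (P : E -> E) : Prop :=
  [/\ open V, holo V P
    & forall th0, V th0 -> exists th : Ch -> R -> E,
        [/\ horizontal_lift h gam th, th a0 0 = th0 & th a1 1 = P th0]].

Definition symplectic_connection (Om : Ch -> E -> 'M[C]_n)
    (h : Ch -> TE -> E -> TE) : Prop :=
  forall gam a0 a1 V P, C1_path gam ->
    atlas a0 -> cdom a0 (gam 0) -> atlas a1 -> cdom a1 (gam 1) ->
    parallel_transport h gam a0 a1 V P ->
  forall th0 u v, V th0 ->
    mxform (Om a1 (cmap a1 (gam 1))) ('d P th0 u) ('d P th0 v)
    = mxform (Om a0 (cmap a0 (gam 0))) u v.

Definition pre_Joyce (Om : Ch -> E -> 'M[C]_n) (h : Ch -> TE -> E -> TE) : Prop :=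
  connection h /\
  forall eps : C, eps != 0 ->
    flat_connection (pencil h eps) /\ symplectic_connection Om (pencil h eps).

(* A linear connection nabla is given by its Christoffel symbols:
   nabla_X Y = dY(X) + D(X, Y). *)
Definition cov (D : Ch -> E -> E -> E -> E) (a : Ch) (Y : E -> E) (z X : E) : E :=
  'd Y z X + D a z X (Y z).

Definition cov_form (D : Ch -> E -> E -> E -> E) (a : Ch) (al : E -> E -> C)
    (z X : E) (Y : E -> E) : C :=
  'd ((fun z' => al z' (Y z')) : E -> C) z X - al z (cov D a Y z X).

Definition ehresmann (D : Ch -> E -> E -> E -> E) : Ch -> TE -> E -> TE :=
  fun a w X => (X, - D a w.1 X w.2).

Definition linear_connection (D : Ch -> E -> E -> E -> E) : Prop :=
  (forall a z X, atlas a -> img a z -> linear (D a z X)) /\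
  connection (ehresmann D).

(* Full lattices in C^n: a finitely generated torsion-free group is free, and
   Gamma (x) C = C^n says that a Z-basis of Gamma (the rows of G) is a C-basis;
   discreteness is then automatic. *)
Definition integer_span (G : 'M[C]_n) : set E :=
  [set u | exists m : 'rV[int]_n, u = map_mx intr m *m G].

Definition lattice_bundle (Gam : Ch -> E -> set E) : Prop :=
  (forall a b z u, atlas a -> atlas b -> overlap a b z ->
     (Gam a z u <-> Gam b (trans a b z) ('d (trans a b) z u))) /\
  (forall a z0, atlas a -> img a z0 ->
     exists (O : set E) (G : E -> 'M[C]_n),
       [/\ open O, O z0, O `<=` img a, holo O G
         & forall z, O z -> G z \in unitmx /\ Gam a z = integer_span (G z)]).

Definition lattice_section (Gam : Ch -> E -> set E) (a : Ch) (O : set E)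
    (s : E -> E) : Prop :=
  local_field a O s /\ forall z, O z -> Gam a z (s z).

Definition lattice_connection (Gam : Ch -> E -> set E)
    (D : Ch -> E -> E -> E -> E) : Prop :=
  [/\ linear_connection D, flat_connection (ehresmann D)
    & forall a O s, atlas a -> lattice_section Gam a O s ->
        forall z X, O z -> cov D a s z X = 0].

Definition period_structure (Gam : Ch -> E -> set E)
    (D : Ch -> E -> E -> E -> E) (Z : Ch -> E -> E) : Prop :=
  [/\ lattice_bundle Gam, lattice_connection Gam D, vector_field Z
    & forall a z X, atlas a -> img a z -> cov D a (Z a) z X = X].

Definition twopii : C := (pi *+ 2)%:C * 'i.

Definition is_integer (x : C) : Prop := exists k : int, x = k%:~R.

Definition dual_lattice (L : set E) : set E :=
  [set al | forall u, L u -> is_integer ((u *m al^T) 0 0)].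

(* Invariance of h, in the chart a over O, under a fibre-preserving map t of TM
   covering the identity of M. *)
Definition invariant_under (h : Ch -> TE -> E -> TE) (a : Ch) (O : set E)
    (t : TE -> TE) : Prop :=
  forall w X, O w.1 -> h a (t w) X = 'd t w (h a w X).

Record Joyce_structure (Om : Ch -> E -> 'M[C]_n) (Gam : Ch -> E -> set E)
    (D : Ch -> E -> E -> E -> E) (Z : Ch -> E -> E)
    (h : Ch -> TE -> E -> TE) : Prop := JoyceStructure {
  J_symplectic : symplectic_form Om;
  J_pre : pre_Joyce Om h;
  J_period : period_structure Gam D Z;
  J1 : forall a z al be, atlas a -> img a z ->
    dual_lattice (Gam a z) al -> dual_lattice (Gam a z) be ->
    is_integer (twopii^-1 * mxform (invmx (Om a z)) al be);
  J2 : forall a O s, atlas a -> lattice_section Gam a O s ->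
    invariant_under h a O (fun w => (w.1, w.2 + twopii *: s w.1));
  J3 : forall a O X, atlas a -> local_field a O X -> forall w, O w.1 ->
    hlift (h a) (bracket (Z a) X) w
    = bracket (hlift (ehresmann D a) (Z a)) (hlift (h a) X) w;
  J4 : forall a, atlas a -> invariant_under h a (img a) (fun w => (w.1, - w.2))
}.

Definition flat_Darboux (Om : Ch -> E -> 'M[C]_n) (D : Ch -> E -> E -> E -> E)
    (c : Ch) : Prop :=
  [/\ atlas c,
      forall (j : 'I_n) O X Y, local_field c O X -> local_field c O Y ->
        forall z, O z -> cov_form D c (fun _ u => u 0 j) z (X z) Y = 0
    & exists K : 'M[C]_n, forall z, img c z -> Om c z = K].

End Objects.

(* Two indexing conventions: for a series g of vector fields without negative
   powers, g k is the coefficient of eps^k; for a series F starting at eps^-1,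
   F m is the coefficient of eps^(m-1). *)
Section Formal.
Context (R : realType) (V : Type) (W : lmodType R[i]).

Definition fact_series (act : V -> W -> W) (g : nat -> V) (F : nat -> W) : nat -> W :=
  fun m => \sum_(j < m.+1) act (g j) (F (m - j)%N).

(* sum over k of (1/k!) (g . )^k F: as g has no constant term, (g . )^k F only
   involves powers of eps at least k - 1, so only k <= m contribute to F m. *)
Definition exp_series (act : V -> W -> W) (g : nat -> V) (F : nat -> W) : nat -> W :=
  fun m => \sum_(k < m.+1) (k`!%:R)^-1 *: iter k (fact_series act g) F m.

End Formal.

Section FormalObjects.
Context (R : realType) (n : nat) (M : complex_manifold R n).
Notation C := R[i].
Notation E := (CV R n).
Notation TE := (TCV R n).
Notation Ch := (chart R n M).

Definition LieG (g : nat -> Ch -> TE -> TE) : Prop :=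
  (forall a w, atlas a -> Timg a w -> g 0%N a w = 0) /\
  (forall k, Tvector_field (g k) /\ vertical (g k)).

Definition vanishes_on_zero_section (g : nat -> Ch -> TE -> TE) : Prop :=
  forall k a z, atlas a -> img a z -> g k a (z, 0) = 0.

Definition relative_connection (h : Ch -> TE -> E -> TE) (a : Ch) (X : E -> E)
  : nat -> (TE -> TE) :=
  fun m => match m with
           | 0 => hlift (@vert R n) X
           | 1 => hlift (h a) X
           | _ => 0
           end.

Definition gauge_transforms (g : nat -> Ch -> TE -> TE)
    (h h' : Ch -> TE -> E -> TE) : Prop :=
  forall a O X, atlas a -> local_field a O X -> forall m w, O w.1 ->
    exp_series (@bracket R TE) (fun k => g k a) (relative_connection h a X) m w
    = relative_connection h' a X m w.

Definition x_st (i : 'I_n) : nat -> (TE -> C) :=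
  fun m => match m with
           | 0 => fun w => - w.1 0 i
           | 1 => fun w => w.2 0 i
           | _ => 0
           end.

Definition x_twisted (g : nat -> Ch -> TE -> TE) (c : Ch) (i : 'I_n)
  : nat -> (TE -> C) :=
  exp_series (@deriv_along R TE C) (fun k => g k c) (x_st i).

Definition x_diff (g : nat -> Ch -> TE -> TE) (c : Ch) (i : 'I_n)
  : nat -> (TE -> C) :=
  fun m w => x_twisted g c i m w - x_st i m w.

Definition polydisc (w0 : TE) (r : R) : set TE :=
  [set w : TE | forall j, `|w.1 0 j - w0.1 0 j| < r%:C /\ `|w.2 0 j - w0.2 0 j| < r%:C].

(* Partial sums, at q = (w, xi), of the Borel transform of the series whose
   coefficient of eps^k is f k. *)
Definition borel_partial (f : nat -> (TE -> C)) (N : nat) (q : TE * C) : C :=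
  \sum_(1 <= k < N.+1) f k q.1 / ((k.-1)`!%:R) * q.2 ^+ k.-1.

End FormalObjects.

(* Main.v *)
(* In flat Darboux coordinates the connection nabla has no Christoffel symbols, so
   the coordinates x_st are annihilated by the lifts A^st_X.  Since e^g intertwines
   the action of A^st with that of A, the functions x = e^g x_st satisfy A_X x = 0, i.e.
   v_X x_{k+1} = - h_X x_k, and x_k vanishes on the zero section for k >= 1
   because g does.  Hence x_{k+1} is obtained from x_k by differentiating once and
   integrating along the ray from the zero section: Cauchy's estimates on shrinking
   balls give |x_k| <= a (q (k+1))^k, and the Borel transform has a positive
   radius of convergence.

   Holomorphy is the bare complex Frechet differentiability, so Cauchy's estimates and
   the holomorphy of derivatives rest on Goursat's argument, with contour integrals
   replaced by trapezoidal sums. *)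
Require Import Defs.
From HB Require Import structures.
From mathcomp Require Import all_boot all_order all_algebra.
From mathcomp Require Import complex.
From mathcomp Require Import all_classical all_reals all_analysis.
From mathcomp Require Import zify ring lra.

Set Implicit Arguments.
Unset Strict Implicit.
Unset Printing Implicit Defensive.

Import Order.TTheory GRing.Theory Num.Theory.
Import numFieldNormedType.Exports.

Local Open Scope classical_set_scope.
Local Open Scope complex_scope.
Local Open Scope ring_scope.

(** The coefficients of [g] are never estimated; they enter through exact facts: e^g carries the
    pair A^st, x_st, in which the first annihilates the second, to the pair A, x, while g has no
    constant term, is vertical and vanishes on the zero section. The growth of the x_k is then read
    off from a recursion that involves only [h], which is bounded near p_0. Each power of eps costs
    one derivative, hence one factor of order k; the factorial in the Borel transform absorbs these
    losses.

    The identity for e^g is a binomial formula for powers of a derivation. It rests on [G, F] f = G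
    F f - F G f, that is, on second differentials that exist and are symmetric. Both properties have
    to be extracted from mere complex differentiability, and Cauchy's estimate for maps into a
    normed module is the tool. Its constant is 16 instead of 1 because the circle is replaced by a
    diamond that is measured crudely; the value affects only the radius obtained for the Borel
    transform. *)

(** * Real-valued norms and differentials in epsilon-delta form *)

Section RealNorm.
Context {R : realType}.
Implicit Types (V W : normedModType R[i]).

(* The norm of a normed R[i]-module takes its values in R[i], which is only
   partially ordered; its real part makes linear arithmetic over R available. *)
Definition nm V (x : V) : R := complex.Re `|x|.

Lemma nmE V (x : V) : `|x| = (nm x)%:C.
Proof. by rewrite /nm RRe_real. Qed.

Lemma nm_ge0 V (x : V) : 0 <= nm x.
Proof. by rewrite -ler0c -nmE. Qed.

Lemma nmD V (x y : V) : nm (x + y) <= nm x + nm y.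
Proof. by rewrite -lecR rmorphD /= -!nmE ler_normD. Qed.

Lemma nmN V (x : V) : nm (- x) = nm x.
Proof. by rewrite /nm normrN. Qed.

Lemma nmBC V (x y : V) : nm (x - y) = nm (y - x).
Proof. by rewrite /nm distrC. Qed.

Lemma nmB V (x y : V) : nm (x - y) <= nm x + nm y.
Proof. by rewrite -[nm y]nmN nmD. Qed.

Lemma nm_tri V (y x z : V) : nm (x - z) <= nm (x - y) + nm (y - z).
Proof. by apply: le_trans (nmD _ _); rewrite addrA subrK. Qed.

Lemma nmZ V (a : R[i]) (x : V) : nm (a *: x) = nm a * nm x.
Proof.
by apply: (@complexI R); rewrite rmorphM /= -!nmE normrZ.
Qed.

Lemma nmM (a b : R[i]) : nm (a * b) = nm a * nm b.
Proof. by rewrite -nmZ. Qed.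

Lemma nmV (a : R[i]) : nm a^-1 = (nm a)^-1.
Proof.
apply: (@complexI R); rewrite fmorphV /= -!nmE.
exact: normfV.
Qed.

Lemma nmX (a : R[i]) k : nm (a ^+ k) = nm a ^+ k.
Proof.
apply: (@complexI R); rewrite rmorphXn /= -!nmE.
exact: normrX.
Qed.

Lemma nm_real (r : R) : nm r%:C = `|r|.
Proof. by rewrite /nm normc_def /= expr0n addr0 sqrtr_sqr. Qed.

Lemma nm_nat (k : nat) : nm (k%:R : R[i]) = k%:R.
Proof. by rewrite -(rmorph_nat (real_complex R)) nm_real ger0_norm. Qed.

Lemma nm_sum V (I : Type) (r : seq I) (P : pred I) (F : I -> V) :
  nm (\sum_(j <- r | P j) F j) <= \sum_(j <- r | P j) nm (F j).
Proof.
elim/big_ind2: _ => // [|x a y b xa yb]; first by rewrite /nm normr0.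
exact: le_trans (nmD _ _) (lerD xa yb).
Qed.

Lemma nm0 V : nm (0 : V) = 0.
Proof. by rewrite /nm normr0. Qed.

Lemma nm_eq0 V (x : V) : (nm x == 0) = (x == 0).
Proof. by rewrite -(inj_eq (@complexI R)) -nmE normr_eq0. Qed.

Lemma nm_gt0 V (x : V) : (0 < nm x) = (x != 0).
Proof. by rewrite lt_def nm_ge0 andbT nm_eq0. Qed.

Lemma nm_small V (x : V) : (forall e : R, 0 < e -> nm x <= e) -> x = 0.
Proof.
move=> xe; apply/eqP; rewrite -nm_eq0 eq_le nm_ge0 andbT leNgt; apply/negP => x0.
by have := xe (nm x / 2) ltac:(lra); lra.
Qed.

Lemma nearP V (x : V) (P : set V) :
  nbhs x P <-> exists2 d : R, 0 < d & forall y, nm (y - x) < d -> P y.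
Proof.
split=> [/nbhs_ballP[e /= e0 eP]|[d d0 dP]].
  move: e0; rewrite ltcE /= => /andP[/eqP ime re0].
  exists (complex.Re e) => // y yx; apply: eP.
  rewrite -ball_normE /= distrC nmE.
  suff -> : e = (complex.Re e)%:C by rewrite ltcR.
  by case: e ime {re0 yx} => ? ? /= ->.
apply/nbhs_ballP; exists d%:C; first by rewrite /= (ltcR 0).
move=> y; rewrite -ball_normE /= distrC nmE ltcR; exact: dP.
Qed.

Lemma open_nmP V (A : set V) (x : V) : open A -> A x ->
  exists2 d : R, 0 < d & forall y, nm (y - x) < d -> A y.
Proof. by move=> oA Ax; apply/nearP; exact: open_nbhs_nbhs. Qed.

Lemma diff_approx V W (f : V -> W) (x : V) : differentiable f x ->
  forall e : R, 0 < e -> exists2 d : R, 0 < d & forall u, nm u < d ->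
    nm (f (x + u) - f x - 'd f x u) <= e * nm u.
Proof.
move=> df e e0.
have := diff_locally df => /eqaddoP /(_ e%:C).
rewrite (ltcR 0) => /(_ e0) /nearP [d d0 H].
exists d => // u ud; have := H u.
rewrite subr0 => /(_ ud).
rewrite !nmE -rmorphM lecR /=.
by rewrite opprD addrA [x + u]addrC.
Qed.

Lemma diff_bounded V W (f : V -> W) (x : V) : differentiable f x ->
  exists2 K : R, 0 < K & forall u, nm ('d f x u) <= K * nm u.
Proof.
move=> df.
have [k /= k0 H] := linear_lipschitz (diff_continuous df).
exists (complex.Re k); first by move: k0; rewrite ltcE => /andP[].
move=> u; have := H u.
have kE : k = (complex.Re k)%:C.
  by move: k0; rewrite ltcE /= => /andP[/eqP + _]; case: (k) => ? ? /= ->.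
by rewrite [X in _ <= X * _]kE !nmE -rmorphM lecR.
Qed.

(** The bound [K] makes [L] continuous, as a Frechet differential must be in a normed module of any
    dimension; uniqueness of the first-order expansion then identifies ['d f x] with [L]. *)
Lemma diff_intro V W (f : V -> W) (x : V) (L : V -> W) (K : R) :
  linear L -> (forall u, nm (L u) <= K * nm u) ->
  (forall e : R, 0 < e -> exists2 d : R, 0 < d & forall u, nm u < d ->
    nm (f (x + u) - f x - L u) <= e * nm u) ->
  differentiable f x /\ 'd f x = L :> (V -> W).
Proof.
move=> linL LK H.
pose LM := GRing.isLinear.Build _ _ _ _ L linL.
pose LL : {linear V -> W} := HB.pack L LM.
have cL : continuous LL.
  move=> y; apply/cvgrPdist_lt => e e0.
  apply/nearP.
  have eE : e = (complex.Re e)%:C.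
    by move: e0; rewrite ltcE /= => /andP[/eqP + _]; case: (e) => ? ? /= ->.
  have e0' : 0 < complex.Re e by move: e0; rewrite ltcE => /andP[].
  have K1 : 0 < `|K| + 1 by rewrite ltr_wpDl.
  exists (complex.Re e / (`|K| + 1)); first by rewrite divr_gt0.
  move=> z; rewrite ltr_pdivlMr // => zy.
  rewrite eE nmE ltcR -linearB /=; apply: le_lt_trans (LK _) _.
  rewrite nmBC; apply: le_lt_trans zy.
  rewrite mulrC ler_wpM2l ?nm_ge0 //.
  by apply: le_trans (ler_norm K) _; rewrite lerDl.
have fo : f \o shift x = cst (f x) + LL +o_ 0 id.
  apply/eqaddoP => e e0.
  have eE : e = (complex.Re e)%:C.
    by move: e0; rewrite ltcE /= => /andP[/eqP + _]; case: (e) => ? ? /= ->.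
  have [|d d0 Hd] := H (complex.Re e); first by move: e0; rewrite ltcE => /andP[].
  apply/nearP; exists d => // u; rewrite subr0 => /Hd.
  by rewrite {2}eE !nmE -rmorphM lecR /= opprD addrA [x + u]addrC.
have dE : 'd f x = L :> (V -> W) by exact: (diff_unique cL fo).
split => //; apply/diff_locallyP.
have -> : ('d f x : V -> W) = LL by exact: dE.
by split.
Qed.

End RealNorm.

(** * Goursat's theorem for trapezoidal sums *)

Section Goursat.
Context {R : realType}.
Notation C := R[i].

(* The only form of completeness that is needed below. *)
Definition geo_complete (W : normedModType C) : Prop :=
  forall (a : nat -> W) (K : R), (forall k, nm (a k.+1 - a k) <= K * 2^-1 ^+ k) ->
  exists l, forall k, nm (a k - l) <= 4 * K * 2^-1 ^+ k.

(** Shifting [a k] down and up by [2 K 2^-k] gives a nondecreasing and a nonincreasing sequence; the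
    supremum of the lower one is squeezed between the two. *)
Lemma geo_real (a : nat -> R) (K : R) :
  (forall k, `|a k.+1 - a k| <= K * 2^-1 ^+ k) ->
  exists l, forall k, `|a k - l| <= 2 * K * 2^-1 ^+ k.
Proof.
move=> aK.
pose b k := a k - 2 * K * 2^-1 ^+ k; pose c k := a k + 2 * K * 2^-1 ^+ k.
have K0 : 0 <= K by have := le_trans (normr_ge0 _) (aK 0%N); rewrite expr0 mulr1.
have h0 k : 0 <= K * 2^-1 ^+ k by rewrite mulr_ge0 // exprn_ge0 // invr_ge0.
have bS k : b k <= b k.+1.
  rewrite /b exprS; have := aK k; have := h0 k.
  by rewrite ler_norml => ? /andP[? ?]; lra.
have cS k : c k.+1 <= c k.
  rewrite /c exprS; have := aK k; have := h0 k.
  by rewrite ler_norml => ? /andP[? ?]; lra.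
have bm k m : (k <= m)%N -> b k <= b m.
  by move=> km; apply: (@homo_leq _ b (fun x y => x <= y)) km => // ? ? ?; exact: le_trans.
have cm k m : (k <= m)%N -> c m <= c k.
  move=> km; apply: (@homo_leq _ c (fun x y => y <= x)) km => // x y z yx zy.
  exact: le_trans zy yx.
have bc k m : b k <= c m.
  apply: le_trans (bm _ _ (leq_maxl k m)) _; apply: le_trans (cm _ _ (leq_maxr k m)).
  by rewrite /b /c; have := h0 (maxn k m); lra.
have sb : has_sup (range b).
  split; first by exists (b 0%N), 0%N.
  by exists (c 0%N) => _ [k _ <-]; exact: bc.
exists (sup (range b)) => k.
have bs : b k <= sup (range b) by apply: sup_upper_bound => //; exists k.
have sc : sup (range b) <= c k.
  by apply: sup_le_ub; [case: sb | move=> _ [m _ <-]; exact: bc].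
by rewrite ler_norml; apply/andP; move: bs sc; rewrite /b /c; split; lra.
Qed.

Lemma Re_le_nm (z : C) : `|complex.Re z| <= nm z.
Proof. by rewrite -lecR -nmE normc_ge_Re. Qed.

Lemma Im_le_nm (z : C) : `|complex.Im z| <= nm z.
Proof.
rewrite /nm normc_def /= -sqrtr_sqr; apply: ler_wsqrtr.
by rewrite lerDr sqr_ge0.
Qed.

Lemma nm_le_ReIm (z : C) : nm z <= `|complex.Re z| + `|complex.Im z|.
Proof.
have i1 : nm ('i%C : C) = 1.
  by rewrite /nm normc_def /= expr0n /= expr1n add0r sqrtr1.
by rewrite {1}[z]complexE; apply: le_trans (nmD _ _) _; rewrite nmM !nm_real i1 mul1r.
Qed.

Lemma geo_complex : geo_complete C.
Proof.
move=> a K aK.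
have [x xP] : exists l, forall k, `|complex.Re (a k) - l| <= 2 * K * 2^-1 ^+ k.
  by apply: geo_real => k; apply: le_trans (aK k); rewrite -raddfB; exact: Re_le_nm.
have [y yP] : exists l, forall k, `|complex.Im (a k) - l| <= 2 * K * 2^-1 ^+ k.
  by apply: geo_real => k; apply: le_trans (aK k); rewrite -raddfB; exact: Im_le_nm.
exists (x +i* y) => k; apply: le_trans (nm_le_ReIm _) _.
have := lerD (xP k) (yP k); rewrite !raddfB /=; lra.
Qed.

Context {W : normedModType C}.
Implicit Types (f : C -> W) (H : set C).

Definition mid (a b : C) : C := 2^-1 * (a + b).

(* Trapezoidal sum of f over the dyadic subdivision of level N of [a, b].  It is
   exact on affine functions and antisymmetric in (a, b), so that the cancellations
   of Goursat's proof hold exactly at each level and no integral has to be defined. *)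
Fixpoint tz f (N : nat) (a b : C) : W :=
  if N is N'.+1 then tz f N' a (mid a b) + tz f N' (mid a b) b
  else (2^-1 * (b - a)) *: (f a + f b).

Lemma midC a b : mid a b = mid b a.
Proof. by rewrite /mid addrC. Qed.

Lemma tz_opp f N a b : tz f N b a = - tz f N a b.
Proof.
elim: N a b => [|N IH] a b /=; last by rewrite midC IH [X in _ + X]IH -opprD addrC.
by rewrite -scaleNr -mulrN opprB [f b + _]addrC.
Qed.

Lemma tzD f1 f2 N a b : tz (fun z => f1 z + f2 z) N a b = tz f1 N a b + tz f2 N a b.
Proof.
elim: N a b => [|N IH] a b /=; last by rewrite !IH addrACA.
by rewrite addrACA scalerDr.
Qed.

Lemma tzN f N a b : tz (fun z => - f z) N a b = - tz f N a b.
Proof.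
elim: N a b => [|N IH] a b /=; last by rewrite !IH opprD.
by rewrite -opprD scalerN.
Qed.

(** The right-hand side is the increment of a primitive from [a] to [b], so it sums to zero around a
    triangle. *)
Lemma tz_affine (p : C) (c l : W) N a b :
  tz (fun z => c + (z - p) *: l) N a b =
  (b - a) *: c + (2^-1 * ((b - p) ^+ 2 - (a - p) ^+ 2)) *: l.
Proof.
elim: N a b => [|N IH] a b /=.
  rewrite addrACA -scalerDl !scalerDr !scalerA -scalerDl.
  congr (_ *: _ + _ *: _); by field.
rewrite !IH addrACA -!scalerDl /mid; congr (_ *: _ + _ *: _); by field.
Qed.

(** The weak form of convexity that suffices here, since dyadic subdivision only ever takes
    midpoints. *)
Definition midconv H := forall a b, H a -> H b -> H (mid a b).

Lemma tz_bound H f K N a b : midconv H -> (forall z, H z -> nm (f z) <= K) ->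
  H a -> H b -> nm (tz f N a b) <= K * nm (b - a).
Proof.
move=> mH fK; elim: N a b => [|N IH] a b Ha Hb /=.
  rewrite nmZ nmM nmV nm_nat mulrAC mulrC [leRHS]mulrC ler_wpM2l ?nm_ge0 //.
  by have := nmD (f a) (f b); have := fK _ Ha; have := fK _ Hb; lra.
have Hm := mH _ _ Ha Hb.
apply: le_trans (nmD _ _) _; apply: le_trans (lerD (IH _ _ Ha Hm) (IH _ _ Hm Hb)) _.
have -> : b - mid a b = 2^-1 * (b - a) by rewrite /mid; field.
have -> : mid a b - a = 2^-1 * (b - a) by rewrite /mid; field.
by rewrite nmM nmV nm_nat; lra.
Qed.

Definition tri f N (t : C * C * C) : W :=
  tz f N t.1.1 t.1.2 + tz f N t.1.2 t.2 + tz f N t.2 t.1.1.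

(** The recursion of [tz] splits the outer edges at their midpoints, at the price of one level; each
    inner edge is run through in both directions and cancels by [tz_opp]. *)
Lemma tri_split f N a b c : tri f N.+1 (a, b, c) =
  tri f N (a, mid a b, mid c a) + tri f N (mid a b, b, mid b c)
  + tri f N (mid c a, mid b c, c) + tri f N (mid a b, mid b c, mid c a).
Proof.
rewrite /tri /=.
rewrite (tz_opp _ _ (mid b c) (mid a b)) (tz_opp _ _ (mid c a) (mid b c)).
rewrite (tz_opp _ _ (mid a b) (mid c a)).
rewrite [RHS](AC (3*3*3*3) (1*4*5*8*9*3*(2*12)*(6*10)*(7*11)))%AC.
by rewrite /= !subrr !addr0 ?addrA.
Qed.

(* Asking for arbitrarily large N lets the pigeonhole principle choose a bad
   subtriangle although N drops by one at each subdivision. *)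
Let tri_bad f (e : R) (t : C * C * C) :=
  forall N0, exists2 N, (N0 <= N)%N & e < nm (tri f N t).

Let Hin H (t : C * C * C) := [/\ H t.1.1, H t.1.2 & H t.2].

Let diam_le (d : R) (t : C * C * C) :=
  [/\ nm (t.1.2 - t.1.1) <= d, nm (t.2 - t.1.2) <= d & nm (t.1.1 - t.2) <= d].

Let nm_half (d : R) (x y : C) : nm y <= d -> x = 2^-1 * y -> nm x <= 2^-1 * d.
Proof. by move=> yd ->; rewrite nmM nmV nm_nat ler_wpM2l. Qed.

Let nm_halfN (d : R) (x y : C) : nm y <= d -> x = - (2^-1 * y) -> nm x <= 2^-1 * d.
Proof. by move=> yd ->; rewrite nmN; exact: (nm_half yd). Qed.

(** If all four half-size triangles were eventually at most [e / 4], then beyond the four thresholds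
    the large one would be at most [e]. The last conjunct makes the first vertices of successive
    triangles a geometrically convergent sequence. *)
Let tri_bad_step H f (e d : R) t : midconv H -> Hin H t -> diam_le d t -> tri_bad f e t ->
  exists t', [/\ Hin H t', diam_le (2^-1 * d) t', tri_bad f (4^-1 * e) t'
    & nm (t'.1.1 - t.1.1) <= d].
Proof.
case: t => [[a b] c] mH [/= Ha Hb Hc] [/= ab bc ca] bad.
have Hab := mH _ _ Ha Hb; have Hbc := mH _ _ Hb Hc; have Hca := mH _ _ Hc Ha.
pose t1 := (a, mid a b, mid c a); pose t2 := (mid a b, b, mid b c).
pose t3 := (mid c a, mid b c, c); pose t4 := (mid a b, mid b c, mid c a).
have d0 : 0 <= d := le_trans (nm_ge0 _) ab.
have hd x : nm x <= 2^-1 * d -> nm x <= d by lra.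
have g1 : [/\ Hin H t1, diam_le (2^-1 * d) t1 & nm (t1.1.1 - a) <= d].
  rewrite /t1; split; [by split | split=> /= | by rewrite subrr nm0].
  - by apply: (nm_half ab); rewrite /mid; field.
  - by apply: (nm_half bc); rewrite /mid; field.
  - by apply: (nm_half ca); rewrite /mid; field.
have g2 : [/\ Hin H t2, diam_le (2^-1 * d) t2 & nm (t2.1.1 - a) <= d].
  rewrite /t2; split; [by split | split=> /= | apply: hd => /=].
  - by apply: (nm_half ab); rewrite /mid; field.
  - by apply: (nm_half bc); rewrite /mid; field.
  - by apply: (nm_half ca); rewrite /mid; field.
  - by apply: (nm_half ab); rewrite /mid; field.
have g3 : [/\ Hin H t3, diam_le (2^-1 * d) t3 & nm (t3.1.1 - a) <= d].
  rewrite /t3; split; [by split | split=> /= | apply: hd => /=].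
  - by apply: (nm_half ab); rewrite /mid; field.
  - by apply: (nm_half bc); rewrite /mid; field.
  - by apply: (nm_half ca); rewrite /mid; field.
  - by apply: (nm_halfN ca); rewrite /mid; field.
have g4 : [/\ Hin H t4, diam_le (2^-1 * d) t4 & nm (t4.1.1 - a) <= d].
  rewrite /t4; split; [by split | split=> /= | apply: hd => /=].
  - by apply: (nm_halfN ca); rewrite /mid; field.
  - by apply: (nm_halfN ab); rewrite /mid; field.
  - by apply: (nm_halfN bc); rewrite /mid; field.
  - by apply: (nm_half ab); rewrite /mid; field.
apply: contrapT => nex.
have nb t : [/\ Hin H t, diam_le (2^-1 * d) t & nm (t.1.1 - a) <= d] ->
    exists N0, forall N, (N0 <= N)%N -> nm (tri f N t) <= 4^-1 * e.
  move=> [h1 h2 h3]; apply: contrapT => nN; apply: nex; exists t; split=> // N0.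
  apply: contrapT => nN'; apply: nN; exists N0 => N N0N.
  by rewrite leNgt; apply/negP => eN; apply: nN'; exists N.
have [N1 H1] := nb _ g1; have [N2 H2] := nb _ g2.
have [N3 H3] := nb _ g3; have [N4 H4] := nb _ g4.
(* The successor pays for the level lost in [tri_split]. *)
have [[//|N]] := bad (N1 + N2 + N3 + N4).+1.
rewrite ltnS => NN; apply/negP; rewrite -leNgt tri_split.
have := nmD (tri f N t1 + tri f N t2 + tri f N t3) (tri f N t4).
have := nmD (tri f N t1 + tri f N t2) (tri f N t3).
have := nmD (tri f N t1) (tri f N t2).
have := H1 N ltac:(lia); have := H2 N ltac:(lia).
have := H3 N ltac:(lia); have := H4 N ltac:(lia).
by rewrite /t1 /t2 /t3 /t4; lra.
Qed.

Definition seq_closed H :=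
  forall p, (forall e : R, 0 < e -> exists2 z, H z & nm (z - p) < e) -> H p.

Lemma geo_small (K e : R) : 0 < e -> exists k, K * 2^-1 ^+ k < e.
Proof.
move=> e0; have [K0|K0] := leP K 0.
  by exists 0%N; rewrite expr0 mulr1; apply: le_lt_trans e0.
exists (Num.truncn (K / e)).+1.
rewrite exprVn ltr_pdivrMr ?exprn_gt0 // -ltr_pdivrMl // mulrC.
apply: lt_trans (truncnS_gt _) _.
rewrite -natrX ltr_nat; exact: ltn_expl.
Qed.

Lemma goursat H f a b c : midconv H -> seq_closed H ->
  (forall z, H z -> differentiable f z) -> H a -> H b -> H c ->
  forall e : R, 0 < e -> exists N0, forall N, (N0 <= N)%N -> nm (tri f N (a, b, c)) <= e.
Proof.
move=> mH cH df Ha Hb Hc e e0; apply: contrapT => nN.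
have bad0 : tri_bad f e (a, b, c).
  move=> N0; apply: contrapT => nN'; apply: nN; exists N0 => N N0N.
  by rewrite leNgt; apply/negP => eN; apply: nN'; exists N.
pose d := nm (b - a) + nm (c - b) + nm (a - c).
have [d1 d2 d3] : [/\ 0 <= nm (b - a), 0 <= nm (c - b) & 0 <= nm (a - c)].
  by split; exact: nm_ge0.
have dd0 : diam_le d (a, b, c) by rewrite /d; split=> /=; lra.
have d0 : 0 <= d by rewrite /d; lra.
pose h k : R := 2^-1 ^+ k.
have h0 k : 0 < h k by rewrite exprn_gt0 // invr_gt0.
have hz : h 0%N = 1 by rewrite /h expr0.
have hS k : h k.+1 = 2^-1 * h k by rewrite /h exprS.
pose Inv k t := [/\ Hin H t, diam_le (d * h k) t & tri_bad f (h k ^+ 2 * e) t].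
(* Outside the invariant [t] itself serves as a default value, so that [choice] gives a total step
   function. *)
have ex (kt : nat * (C * C * C)) : exists t', Inv kt.1 kt.2 ->
    Inv kt.1.+1 t' /\ nm (t'.1.1 - kt.2.1.1) <= d * h kt.1.
  case: kt => k t /=; have [It|] := pselect (Inv k t); last by exists t.
  case: It => Ht dt bt; have [t' [H't d't b't tt']] := tri_bad_step mH Ht dt bt.
  exists t' => _; split=> //; split=> //.
    by move: d't; congr (diam_le _ _); rewrite hS; ring.
  by move: b't; congr (tri_bad _ _ _); rewrite hS; move: (h k) => y; field.
have [F' HF'] := choice ex.
pose F k t := F' (k, t); have HF k t := HF' (k, t).
pose T := fix T k := if k is k'.+1 then F k' (T k') else (a, b, c).
have IT k : Inv k (T k).
  elim: k => [|k IH] /=; last by have [] := HF k _ IH.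
  by split; rewrite /= ?hz ?mulr1 ?expr1n ?mul1r.
have [p pT] := @geo_complex (fun k => (T k).1.1) d (fun k => (HF k _ (IT k)).2).
have Hp : H p.
  apply: cH => x x0; have [k kx] := geo_small (4 * d) x0.
  by exists (T k).1.1; [case: (IT k) => -[] | apply: le_lt_trans (pT k) kx].
(* The [k]-th triangle lies within [5 d 2^-k] of [p]: 4 comes from [geo_complex] and 1 from the
   diameter. Three edges of length at most [d 2^-k] make it 15; the summand 1 covers [d = 0]. *)
pose eta := e / (15 * d ^+ 2 + 1).
have q0 : 0 < 15 * d ^+ 2 + 1 by rewrite ltr_wpDl // mulr_ge0 // sqr_ge0.
have eta0 : 0 < eta by rewrite divr_gt0.
have [del del0 fdel] := diff_approx (df _ Hp) eta0.
have [k kd] := geo_small (5 * d) del0.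
have [[A B D] [dA dB dD] bad] := IT k.
pose r := 5 * d * h k.
pose H' := H `&` [set z | nm (z - p) <= r].
have mH' : midconv H'.
  move=> x y [Hx /= xr] [Hy /= yr]; split; first exact: mH.
  rewrite /= /mid; have -> : 2^-1 * (x + y) - p = 2^-1 * ((x - p) + (y - p)) by field.
  by rewrite nmM nmV nm_nat; have := nmD (x - p) (y - p); lra.
have dh0 : 0 <= d * h k by rewrite mulr_ge0 // ltW.
have HA : H' (T k).1.1 by split=> //=; apply: le_trans (pT k) _; rewrite /r /h in dh0 *; lra.
have pTk : nm ((T k).1.1 - p) <= 4 * (d * h k) by have := pT k; rewrite /h; lra.
have HB : H' (T k).1.2.
  by split=> //=; have := nm_tri (T k).1.1 (T k).1.2 p; rewrite /r; lra.
have HD : H' (T k).2.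
  by split=> //=; have := nm_tri (T k).1.1 (T k).2 p; rewrite [nm (_ - (T k).1.1)]nmBC /r; lra.
pose aff z : W := f p + (z - p) *: ('d f p 1).
have gb z : H' z -> nm (f z - aff z) <= eta * r.
  move=> [Hz /= zr].
  have := fdel (z - p) (le_lt_trans zr kd).
  have -> : 'd f p (z - p) = (z - p) *: 'd f p 1 by rewrite -linearZ /= [_ *: _]mulr1.
  rewrite addrCA subrr addr0 /aff opprD addrA => /le_trans; apply.
  by rewrite ler_wpM2l // ltW.
(* The affine part of [f] at [p] contributes exactly zero at every level, so only the first-order
   error remains. *)
have tE N : tri f N (T k) = tri (fun z => f z - aff z) N (T k).
  rewrite /tri !tzD !tzN !tz_affine.
  rewrite [X in _ = X + _]addrACA -opprD [RHS]addrACA -opprD.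
  rewrite [Y in _ = _ - (Y + _)]addrACA -!scalerDl.
  rewrite [Y in _ = _ - Y]addrACA -!scalerDl.
  rewrite [Y in _ = _ - (Y *: _ + _)](_ : _ = 0); last by ring.
  rewrite [Y in _ = _ - (_ + Y *: _)](_ : _ = 0); last by ring.
  by rewrite !scale0r addr0 subr0.
have [N _] := bad 0%N; apply/negP; rewrite -leNgt tE /tri.
have er0 : 0 <= eta * r by rewrite mulr_ge0 ?(ltW eta0) // /r -mulrA mulr_ge0.
have tb x y : H' x -> H' y -> nm (y - x) <= d * h k ->
    nm (tz (fun z => f z - aff z) N x y) <= (eta * r) * (d * h k).
  move=> Hx Hy xy; apply: le_trans (tz_bound N mH' gb Hx Hy) _.
  exact: ler_wpM2l.
set x1 := tz _ _ _ _; set x2 := tz _ _ _ _; set x3 := tz _ _ _ _.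
have := nmD (x1 + x2) x3; have := nmD x1 x2.
have := tb _ _ HA HB dA; have := tb _ _ HB HD dB; have := tb _ _ HD HA dD.
rewrite -/x1 -/x2 -/x3.
suff : 3 * (eta * r * (d * h k)) <= h k ^+ 2 * e by lra.
have -> : 3 * (eta * r * (d * h k)) = h k ^+ 2 * (eta * (15 * d ^+ 2)) by rewrite /r; ring.
rewrite ler_wpM2l ?sqr_ge0 // /eta mulrAC ler_pdivrMr // ler_wpM2l ?(ltW e0) //.
by rewrite lerDl.
Qed.

End Goursat.

Section ScaleDiff.
Context {R : realType} {V W : normedModType R[i]}.

Let scal (a : R[i]) (w : W) : W := a *: w.

Let scal_is_bilinear : bilinear_for
  (GRing.Scale.Law.clone _ _ *:%R _) (GRing.Scale.Law.clone _ _ *:%R _) scal.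
Proof.
split=> [w|b] a x y; rewrite /scal /=; first by rewrite scalerDl scalerA.
by rewrite scalerDr !scalerA mulrC.
Qed.

Lemma differentiable_scale (k : V -> R[i]) (f : V -> W) (x : V) :
  differentiable k x -> differentiable f x -> differentiable (fun y => k y *: f y) x.
Proof.
move=> dk df.
pose bM := bilinear_isBilinear.Build _ _ _ _ _ _ scal scal_is_bilinear.
pose b : {bilinear R[i] -> W -> W} := HB.pack scal bM.
have cb : continuous (fun p : R[i] * W => b p.1 p.2) by exact: scale_continuous.
exact: (differentiable_comp (differentiable_pair dk df) (@differentiable_bilin _ _ _ _ b (k x, f x) cb)).
Qed.

End ScaleDiff.

(** * Cauchy's theorem on diamonds around a singularity *)

Section Diamond.
Context {R : realType}.
Notation C := R[i].
Notation i := ('i%C : C).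

(** The linear functional that is constant on the edge from 1 to [i]. For [v = u^-1] the condition
    [h <= ri (v * z)] describes the half-plane beyond the edge from [h u] to [h i u]. *)
Definition ri (z : C) : R := complex.Re z + complex.Im z.

Lemma riD z w : ri (z + w) = ri z + ri w.
Proof. by rewrite /ri !raddfD /=; ring. Qed.

Lemma riZ (a : R) z : ri (a%:C * z) = a * ri z.
Proof. by case: z => x y; rewrite /ri /=; ring. Qed.

Lemma ri_unit (a : R) (u v : C) : v * u = 1 -> ri (v * (a%:C * u)) = a.
Proof. by move=> vu; rewrite (mulrCA v a%:C u) vu riZ /ri /= addr0 mulr1. Qed.

Lemma ri_uniti (a : R) (u v : C) : v * u = 1 -> ri (v * (a%:C * (i * u))) = a.
Proof.
move=> vu; rewrite (mulrCA v a%:C (i * u)) (mulrCA v i u) vu mulr1 riZ.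
by rewrite /ri /= add0r mulr1.
Qed.

Lemma ri_le z : `|ri z| <= 2 * nm z.
Proof.
have := ler_normD (complex.Re z) (complex.Im z).
by have := Re_le_nm z; have := Im_le_nm z; rewrite /ri; lra.
Qed.

Lemma nm_i : nm i = 1.
Proof. by rewrite /nm normc_def /= expr0n /= expr1n add0r sqrtr1. Qed.

Lemma nm_unit (a : R) (u : C) : 0 <= a -> nm u = 1 -> nm (a%:C * u) = a.
Proof. by move=> a0 nu; rewrite nmM nm_real nu mulr1 ger0_norm. Qed.

Lemma nm_uniti (a : R) (u : C) : 0 <= a -> nm u = 1 -> nm (a%:C * (i * u)) = a.
Proof. by move=> a0 nu; rewrite nmM nm_real nmM nm_i mul1r nu mulr1 ger0_norm. Qed.

Lemma midE (a b : C) : mid a b = (2^-1)%:C * (a + b).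
Proof. by rewrite /mid fmorphV /= rmorph_nat. Qed.

Context {W : normedModType C}.
Implicit Types (f : C -> W).

Definition edge f N (h : R) (u : C) : W := tz f N (h%:C * u) (h%:C * (i * u)).

(* Sum along the diamond with vertices h, ih, -h, -ih. *)
Definition dia f N (h : R) : W :=
  edge f N h 1 + edge f N h i + edge f N h (i * i) + edge f N h (i * (i * i)).

(** Each edge lies in a convex set where [h <= ri (v * z)], and [ri_le] turns this into
    [h <= 2 * nm z]: the values of [f] near 0 never enter. Four edges of length at most [2 h] give
    the factor 8. *)
Lemma dia_bound f N h K : 0 <= h ->
  (forall z, h <= 2 * nm z -> nm z <= h -> nm (f z) <= K) -> nm (dia f N h) <= 8 * h * K.
Proof.
move=> h0 fK.
have e (u v : C) : v * u = 1 -> nm u = 1 -> nm v = 1 -> nm (edge f N h u) <= K * (2 * h).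
  move=> vu nu nv.
  pose H := [set z : C | h <= ri (v * z) /\ nm z <= h].
  have mH : midconv H.
    move=> a b [/= ha na] [/= hb nb]; split; rewrite /= midE.
      by rewrite mulrCA riZ [v * (_ + _)]mulrDr riD; lra.
    rewrite nmM nm_real ger0_norm ?invr_ge0 //.
    by have := nmD a b; lra.
  have Ha : H (h%:C * u).
    by rewrite /H; split; rewrite /mkset ?(ri_unit h vu) ?(nm_unit h0 nu).
  have Hb : H (h%:C * (i * u)).
    by rewrite /H; split; rewrite /mkset ?(ri_uniti h vu) ?(nm_uniti h0 nu).
  apply: le_trans (tz_bound N mH _ Ha Hb) _.
    move=> z [/= h1 h2]; apply: fK => //.
    have := ri_le (v * z); rewrite nmM nv mul1r; have := ler_norm (ri (v * z)); lra.
  have K0 : 0 <= K.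
    apply: le_trans (nm_ge0 (f (h%:C * u))) (fK _ _ _);
      by rewrite (nm_unit h0 nu) //; lra.
  rewrite ler_wpM2l //; apply: le_trans (nmB _ _) _.
  by rewrite (nm_unit h0 nu) (nm_uniti h0 nu); lra.
have ii : i * i = -1 :> C by rewrite -expr2 sqr_i.
have n1 : nm (1 : C) = 1 by rewrite -[1]/(1%:C) nm_real normr1.
have nm1 : nm (-1 : C) = 1 by rewrite nmN.
have e1 := e 1 1 (mulr1 1) n1 n1.
have e2 := e i (- i) _ nm_i _.
have e3 := e (i * i) (-1).
have e4 := e (i * (i * i)) i.
have {}e2 : nm (edge f N h i) <= K * (2 * h).
  by apply: e2; rewrite ?nmN ?nm_i // mulNr ii opprK.
have {}e3 : nm (edge f N h (i * i)) <= K * (2 * h).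
  by apply: e3; rewrite ?ii // mulrNN mulr1.
have {}e4 : nm (edge f N h (i * (i * i))) <= K * (2 * h).
  by apply: e4; rewrite ?nmM ?nm_i ?mulr1 // mulrA ii mulrNN mulr1.
rewrite /dia.
move: e1 e2 e3 e4; set x1 := edge _ _ _ _; set x2 := edge _ _ _ _.
set x3 := edge _ _ _ _; set x4 := edge _ _ _ _ => e1 e2 e3 e4.
have := nmD (x1 + x2 + x3) x4; have := nmD (x1 + x2) x3; have := nmD x1 x2; lra.
Qed.

(** The trapezium between two parallel edges is cut by a diagonal into two triangles; its two radial
    sides are left over. *)
Let ring_edge f N (h : R) (u : C) :
  edge f N h u - edge f N (2^-1 * h) u =
  tri f N (h%:C * u, h%:C * (i * u), (2^-1 * h)%:C * (i * u))
  + tri f N (h%:C * u, (2^-1 * h)%:C * (i * u), (2^-1 * h)%:C * u)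
  - (tz f N (h%:C * (i * u)) ((2^-1 * h)%:C * (i * u))
     - tz f N (h%:C * u) ((2^-1 * h)%:C * u)).
Proof.
rewrite /edge /tri /=; set a := h%:C * u; set b := h%:C * (i * u).
set c := _ * (i * u); set d := _ * u.
rewrite (tz_opp _ _ c d) (tz_opp _ _ a c) (tz_opp _ _ a d).
rewrite opprB [RHS](AC (3*3*2) ((1*5)*(2*8)*(4*3)*(7*6)))%AC /=.
by rewrite !subrr !addr0 opprK.
Qed.

Definition dia_dom (h : R) := [set z : C | z != 0 /\ nm z <= h].

(** The half-plane [ri (v * z) >= h / 2] keeps both triangles of the trapezium away from 0, and its
    intersection with the disc is closed and convex as [goursat] requires. Membership in a list lets
    one statement serve both triangles. *)
Let ring_tri f (h : R) (u v : C) : 0 < h -> v * u = 1 -> nm u = 1 -> nm v = 1 ->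
  (forall z, dia_dom h z -> differentiable f z) ->
  forall a b c (e : R), 0 < e ->
  (forall z, z \in [:: a; b; c] -> z \in [:: h%:C * u; h%:C * (i * u);
    (2^-1 * h)%:C * (i * u); (2^-1 * h)%:C * u]) ->
  exists N0, forall N, (N0 <= N)%N -> nm (tri f N (a, b, c)) <= e.
Proof.
move=> h0 vu nu nv df a b c e e0 abc.
pose H := [set z : C | 2^-1 * h <= ri (v * z) /\ nm z <= h].
have mH : midconv H.
  move=> x y [/= hx nx] [/= hy ny]; split; rewrite /= midE.
    by rewrite mulrCA riZ [v * (_ + _)]mulrDr riD; lra.
  rewrite nmM nm_real ger0_norm ?invr_ge0 //.
  by have := nmD x y; lra.
have cH : seq_closed H.
  move=> p pe; split; rewrite /= leNgt; apply/negP => lt.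
    have [z [/= z1 z2] zp] := pe ((2^-1 * h - ri (v * p)) / 2) ltac:(lra).
    have := ri_le (v * (z - p)); rewrite nmM nv mul1r mulrBr.
    have -> : ri (v * z - v * p) = ri (v * z) - ri (v * p).
      by rewrite riD /ri !raddfN /=; ring.
    by have := ler_norm (ri (v * z) - ri (v * p)); lra.
  have [z [/= z1 z2] zp] := pe (nm p - h) ltac:(lra).
  by have := nm_tri z p 0; rewrite !subr0 nmBC; lra.
have HV z : z \in [:: h%:C * u; h%:C * (i * u);
    (2^-1 * h)%:C * (i * u); (2^-1 * h)%:C * u] -> H z.
  have h20 : 0 <= 2^-1 * h by lra.
  have h00 : 0 <= h by lra.
  rewrite !inE => /or4P[] /eqP ->; rewrite /H /mkset.
  - by rewrite (ri_unit h vu) (nm_unit h00 nu); split; lra.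
  - by rewrite (ri_uniti h vu) (nm_uniti h00 nu); split; lra.
  - by rewrite (ri_uniti _ vu) (nm_uniti h20 nu); split; lra.
  - by rewrite (ri_unit _ vu) (nm_unit h20 nu); split; lra.
have dH z : H z -> differentiable f z.
  move=> [/= z1 z2]; apply: df; split => //; apply/eqP => zz.
  by move: z1; rewrite zz mulr0 /ri /=; lra.
by apply: (goursat mH cH dH) => //; apply: HV; apply: abc; rewrite !inE eqxx ?orbT.
Qed.

Let n1 : nm (1 : C) = 1. Proof. by rewrite -[1]/(1%:C) nm_real normr1. Qed.

Let ii : i * i = -1 :> C. Proof. by rewrite -expr2 sqr_i. Qed.

(** The radial sides cancel around the ring. The primed ones are the same sides, obtained with
    [i * 1] instead of [i] and with the fourth power of [i] instead of 1. *)
Let tele (a1 a2 a3 a4 s1 s2 s3 s4 s1' s2' : W) : s1' = s1 -> s2' = s2 ->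
  (a1 - (s2' - s1)) + (a2 - (s3 - s2)) + (a3 - (s4 - s3)) + (a4 - (s1' - s4))
  = a1 + a2 + a3 + a4.
Proof.
move=> -> ->; rewrite !opprB !addrA.
rewrite [LHS](ACl (1*4*7*10*(2*12)*(5*3)*(8*6)*(11*9)))%AC /=.
by rewrite !subrr !addr0.
Qed.

Let dia_halve f (h : R) : 0 < h -> (forall z, dia_dom h z -> differentiable f z) ->
  forall e : R, 0 < e -> exists N0, forall N, (N0 <= N)%N ->
    nm (dia f N h - dia f N (2^-1 * h)) <= e.
Proof.
move=> h0 df e e0.
have T (u v : C) : v * u = 1 -> nm u = 1 -> nm v = 1 -> exists N0, forall N, (N0 <= N)%N ->
  nm (tri f N (h%:C * u, h%:C * (i * u), (2^-1 * h)%:C * (i * u))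
  + tri f N (h%:C * u, (2^-1 * h)%:C * (i * u), (2^-1 * h)%:C * u)) <= e / 4.
  move=> vu nu nv; have RT := ring_tri h0 vu nu nv df.
  have [|z|N1 H1] := RT (h%:C * u) (h%:C * (i * u)) ((2^-1 * h)%:C * (i * u)) (e / 8).
  - by lra.
  - by rewrite !inE => /or3P[] ->; rewrite ?orbT.
  have [|z|N2 H2] := RT (h%:C * u) ((2^-1 * h)%:C * (i * u)) ((2^-1 * h)%:C * u) (e / 8).
  - by lra.
  - by rewrite !inE => /or3P[] ->; rewrite ?orbT.
  exists (N1 + N2)%N => N NN; apply: le_trans (nmD _ _) _.
  by have := H1 N ltac:(lia); have := H2 N ltac:(lia); lra.
have i4 : i * (i * (i * i)) = 1 by rewrite mulrA !ii mulrNN mulr1.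
have [N1 H1] := T 1 1 (mulr1 1) n1 n1.
have [N2 H2] := T i (- i) ltac:(by rewrite mulNr ii opprK) nm_i ltac:(by rewrite nmN nm_i).
have [N3 H3] := T (i * i) (i * i) ltac:(by rewrite ii mulrNN mulr1)
  ltac:(by rewrite nmM nm_i mulr1) ltac:(by rewrite nmM nm_i mulr1).
have [N4 H4] := T (i * (i * i)) i i4 ltac:(by rewrite !nmM nm_i !mulr1) nm_i.
exists (N1 + N2 + N3 + N4)%N => N NN.
have {}H1 := H1 N ltac:(lia); have {}H2 := H2 N ltac:(lia).
have {}H3 := H3 N ltac:(lia); have {}H4 := H4 N ltac:(lia).
have -> : dia f N h - dia f N (2^-1 * h) =
    (edge f N h 1 - edge f N (2^-1 * h) 1) + (edge f N h i - edge f N (2^-1 * h) i)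
  + (edge f N h (i * i) - edge f N (2^-1 * h) (i * i))
  + (edge f N h (i * (i * i)) - edge f N (2^-1 * h) (i * (i * i))).
  by rewrite /dia !opprD !addrA [LHS](ACl (1*5*2*6*3*7*4*8))%AC.
rewrite !ring_edge tele; [|by rewrite i4|by rewrite mulr1].
move: H1 H2 H3 H4; set x1 := _ + _; set x2 := _ + _; set x3 := _ + _; set x4 := _ + _.
have := nmD (x1 + x2 + x3) x4; have := nmD (x1 + x2) x3; have := nmD x1 x2; lra.
Qed.

(* Cauchy's theorem with a removable singularity at 0: between two diamonds lie
   triangles on which f is holomorphic, and the small ones contribute O(e), as z f(z) is small near 0. *)
Lemma dia_lim0 f (h : R) : 0 < h -> (forall z, dia_dom h z -> differentiable f z) ->
  (forall e : R, 0 < e -> exists2 d : R, 0 < d & forall z, z != 0 -> nm z < d ->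
    nm z * nm (f z) <= e) ->
  forall e : R, 0 < e -> exists N0, forall N, (N0 <= N)%N -> nm (dia f N h) <= e.
Proof.
move=> h0 df f0 e e0.
(* On the small diamond [nm z] is at least [hh k / 2], so [dia_bound] gives
   [8 * hh k * (e / 32) / (hh k / 2) = e / 2]. *)
have [d d0 fd] := f0 (e / 32) ltac:(lra).
have [k kd] := geo_small h d0.
pose hh m : R := h * 2^-1 ^+ m.
have hh0 m : 0 < hh m by rewrite mulr_gt0 // exprn_gt0 // invr_gt0.
have hS m : hh m.+1 = 2^-1 * hh m by rewrite /hh exprS mulrCA.
have hz : hh 0%N = h by rewrite /hh expr0 mulr1.
have hle m : hh m <= h by elim: m => [|m IH]; [rewrite hz | rewrite hS; have := hh0 m; lra].
have H m : forall e : R, 0 < e -> exists N0, forall N, (N0 <= N)%N ->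
    nm (dia f N h - dia f N (hh m)) <= e.
  elim: m => [|m IH] e' e'0; first by exists 0%N => N _; rewrite hz subrr nm0 ltW.
  have [N1 H1] := IH (e' / 2) ltac:(lra).
  have dm z : dia_dom (hh m) z -> differentiable f z.
    by move=> [z0 zh]; apply: df; split=> //; apply: le_trans zh (hle m).
  have [N2 H2] := dia_halve (hh0 m) dm (e := e' / 2) ltac:(lra).
  exists (N1 + N2)%N => N NN; rewrite hS.
  have := nm_tri (dia f N (hh m)) (dia f N h) (dia f N (2^-1 * hh m)).
  by have := H1 N ltac:(lia); have := H2 N ltac:(lia); lra.
have [N0 HN] := H k (e / 2) ltac:(lra).
exists N0 => N NN.
have := nm_tri (dia f N (hh k)) (dia f N h) 0; rewrite !subr0.
have := HN N NN.
suff : nm (dia f N (hh k)) <= e / 2 by lra.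
have B : 0 < hh k by [].
have -> : e / 2 = 8 * hh k * (e / 32 / (hh k / 2)) by field; rewrite gt_eqF.
apply: dia_bound; first exact: ltW.
move=> z z1 z2; have z0 : 0 < nm z by lra.
have := fd z _ (le_lt_trans z2 kd); rewrite -nm_gt0 => /(_ z0) zf.
rewrite ler_pdivlMr; last by lra.
apply: le_trans zf; rewrite mulrC ler_wpM2r ?nm_ge0 //; lra.
Qed.

Lemma diaD f1 f2 N h : dia (fun z => f1 z + f2 z) N h = dia f1 N h + dia f2 N h.
Proof.
rewrite /dia /edge !tzD !addrA.
by rewrite [LHS](ACl (1*3*5*7*2*4*6*8))%AC.
Qed.

End Diamond.

(** * Cauchy's estimate in one variable *)

Section Cauchy.
Context {R : realType}.
Notation C := R[i].
Notation i := ('i%C : C).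

(** This is dz / z along the edge from 1 to [i]: the imaginary part equals [(x + y) / (x^2 + y^2)],
    and [x^2 + y^2 <= (x + y)^2 = 1] for nonnegative [x], [y]. *)
Lemma im_inv_edge (z : C) : ri z = 1 -> 0 <= complex.Re z -> 0 <= complex.Im z ->
  1 <= complex.Im ((i - 1) * z^-1).
Proof.
case: z => x y; rewrite /ri /= => xy x0 y0.
have xy2 : (x + y) ^+ 2 = 1 by rewrite xy expr1n.
have n0 : 0 < x ^+ 2 + y ^+ 2 by have := sqr_ge0 (x - y); lra.
have -> : (0 - 1) * - (y / (x ^+ 2 + y ^+ 2)) + (1 - 0) * (x / (x ^+ 2 + y ^+ 2))
  = 1 / (x ^+ 2 + y ^+ 2) by rewrite -[in RHS]xy; ring.
rewrite ler_pdivlMr // mul1r; have := mulr_ge0 x0 y0; lra.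
Qed.

Lemma tz_inv_edge N (a b : C) (l : R) : 0 <= l -> b - a = l%:C * (i - 1) ->
  ri a = 1 -> ri b = 1 ->
  0 <= complex.Re a -> 0 <= complex.Im a -> 0 <= complex.Re b -> 0 <= complex.Im b ->
  l <= complex.Im (tz (@GRing.inv C) N a b).
Proof.
elim: N a b l => [|N IH] a b l l0 ba ra rb ra0 ia0 rb0 ib0 /=.
  have -> : (2^-1 * (b - a)) *: (a^-1 + b^-1) =
     (l / 2)%:C * ((i - 1) * a^-1 + (i - 1) * b^-1).
    rewrite ba rmorphM fmorphV /= rmorph_nat -[LHS]/(_ * _); ring.
  have := im_inv_edge ra ra0 ia0; have := im_inv_edge rb rb0 ib0.
  set p := (_ * _^-1); set q := (_ * _^-1) => P Q.
  have -> : complex.Im ((l / 2)%:C * (q + p)) = l / 2 * (complex.Im q + complex.Im p).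
    by case: (q) => ? ?; case: (p) => ? ? /=; ring.
  nra.
have rm : ri (mid a b) = 1 by rewrite midE riZ riD ra rb; field.
have [rem imm] : 0 <= complex.Re (mid a b) /\ 0 <= complex.Im (mid a b).
  rewrite midE; case: (a) (b) ra0 ia0 rb0 ib0 => ? ? [? ?] /=; split; lra.
have e1 : mid a b - a = (2^-1 * l)%:C * (i - 1).
  by rewrite rmorphM /= -mulrA -ba fmorphV /= rmorph_nat /mid; field.
have e2 : b - mid a b = (2^-1 * l)%:C * (i - 1).
  by rewrite rmorphM /= -mulrA -ba fmorphV /= rmorph_nat /mid; field.
have l20 : 0 <= 2^-1 * l by lra.
have := IH _ _ _ l20 e1 ra rm ra0 ia0 rem imm.
have := IH _ _ _ l20 e2 rm rb rem imm rb0 ib0.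
rewrite raddfD /=; lra.
Qed.

Lemma tz_inv_rot N (u a b : C) : u != 0 ->
  tz (@GRing.inv C) N (u * a) (u * b) = tz (@GRing.inv C) N a b.
Proof.
move=> u0; elim: N a b => [|N IH] a b /=.
  by rewrite -![_ *: _]/(_ * _) !invfM; move: (a^-1) (b^-1) => a' b'; field.
have -> : mid (u * a) (u * b) = u * mid a b by rewrite /mid; ring.
by rewrite !IH.
Qed.

(** A crude substitute for the integral of dz / z being [2 pi i]: by rotation invariance the four
    edges contribute equally, each with imaginary part at least 1, at every level. *)
Lemma dia_inv N : 4 <= nm (dia (@GRing.inv C) N 1).
Proof.
apply: le_trans (Im_le_nm _); apply: le_trans (ler_norm _).
have i0 : i != 0 by rewrite -nm_gt0 nm_i.
have ii : i * i = -1 :> C by rewrite -expr2 sqr_i.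
have E : forall u : C, u != 0 ->
   edge (@GRing.inv C) N 1 u = tz (@GRing.inv C) N 1 i.
  move=> u u0; rewrite /edge -[1%:C]/(1 : C) !mul1r -{1}[u]mulr1 [i * u]mulrC.
  exact: tz_inv_rot.
rewrite /dia !E ?mulf_neq0 ?oner_neq0 //.
have : 1 <= complex.Im (tz (@GRing.inv C) N 1 i).
  apply: tz_inv_edge; rewrite ?ler01 //.
  - by rewrite -[1%:C]/(1 : C) mul1r.
  - by rewrite /ri /= addr0.
  - by rewrite /ri /= add0r.
by rewrite !raddfD /=; lra.
Qed.

Context {W : normedModType C}.

Lemma tz_scale (k : C -> C) (l : W) N a b : tz (fun z => k z *: l) N a b = tz k N a b *: l.
Proof.
elim: N a b => [|N IH] a b /=; last by rewrite !IH scalerDl.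
by rewrite -scalerDl scalerA.
Qed.

Lemma dia_scale (k : C -> C) (l : W) N h : dia (fun z => k z *: l) N h = dia k N h *: l.
Proof. by rewrite /dia /edge !tz_scale -!scalerDl. Qed.

Lemma diaN (f : C -> W) N h : dia (fun z => - f z) N h = - dia f N h.
Proof. by rewrite /dia /edge !tzN -!opprD. Qed.

(* Apply dia_lim0 to (f z - f 0 - z f'(0)) / z^2. *)
Lemma cauchy1 (f : C -> W) (K : R) : (forall z, nm z <= 1 -> differentiable f z) ->
  (forall z, nm z <= 1 -> nm (f z) <= K) -> nm ('d f 0 1) <= 16 * K.
Proof.
move=> df fK.
have n10 : nm (0 : C) <= 1 by rewrite nm0.
have d0 := df 0 n10.
pose l := 'd f 0 1.
pose g z := f z - f 0.
pose G z := z^-1 *: (z^-1 *: g z) + - (z^-1 *: l).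
have dinv (z : C) : z != 0 -> differentiable (@GRing.inv C) z.
  by move=> z0; exact: (@differentiable_Rinv C).
have dG z : dia_dom 1 z -> differentiable G z.
  move=> [z0 z1]; apply: differentiableD.
    apply: differentiable_scale; first exact: dinv.
    apply: differentiable_scale; first exact: dinv.
    by apply: differentiableB; [exact: df | exact: differentiable_cst].
  apply: differentiableN; apply: differentiable_scale; first exact: dinv.
  exact: differentiable_cst.
have G0 (e : R) : 0 < e -> exists2 d : R, 0 < d & forall z, z != 0 -> nm z < d ->
    nm z * nm (G z) <= e.
  move=> e0; have [d dd fd] := diff_approx d0 e0.
  exists d => // z z0 zd; have := fd _ zd.
  have -> : 'd f 0 z = z *: l by rewrite -linearZ /= [_ *: _]mulr1.
  rewrite add0r -/(g z) => gd.
  have -> : G z = z^-1 *: (z^-1 *: (g z - z *: l)).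
    by rewrite /G !scalerBr [z^-1 *: (z *: l)]scalerA mulVf // scale1r.
  have nz : 0 < nm z by rewrite nm_gt0.
  rewrite !nmZ nmV mulrA mulfV ?gt_eqF // mul1r mulrC ler_pdivrMr //.
have K0 : 0 <= K by apply: le_trans (fK 0 n10); exact: nm_ge0.
(* On the diamond [f z - f 0] is at most [2 K] and each factor [z^-1] at most 2, so the sum over the
   diamond is at most [8 * 8 K = 64 K]; dividing by the 4 of [dia_inv] produces the constant 16. *)
have key (e : R) : 0 < e -> 4 * nm l <= 64 * K + e.
  move=> e0; have [N HN] := dia_lim0 ltr01 dG G0 e0.
  have {HN} := HN N (leqnn N).
  rewrite diaD diaN dia_scale => HN.
  set A := dia (fun z => z^-1 *: (z^-1 *: g z)) N 1 in HN.
  have {}HN : nm (A - dia (@GRing.inv C) N 1 *: l) <= e by exact: HN.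
  have AK : nm A <= 64 * K.
    have -> : 64 * K = 8 * 1 * (8 * K) by ring.
    apply: dia_bound => // z z1 z2.
    have zz : nm z^-1 <= 2.
      have z0 : 0 < nm z by lra.
      by rewrite nmV -[_^-1]mul1r ler_pdivrMr.
    have gz : nm (g z) <= 2 * K.
      by have := nmB (f z) (f 0); have := fK _ z2; have := fK _ n10; rewrite /g; lra.
    have -> : 8 * K = 2 * (2 * (2 * K)) by ring.
    by rewrite !nmZ; do 2 (apply: ler_pM; rewrite ?mulr_ge0 ?nm_ge0 //).
  apply: le_trans (ler_wpM2r (nm_ge0 l) (dia_inv N)) _; rewrite -nmZ.
  rewrite -[X in nm X](subKr A); apply: le_trans (nmB _ _) _; exact: lerD.
rewrite -/l -(@ler_pM2l _ 4) // mulrA -natrM.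
by apply/ler_addgt0Pr => e e0; exact: key.
Qed.

End Cauchy.

(** * Cauchy estimates in normed modules *)

Section MeanValue.
Context {R : realType} {W : normedModType R[i]}.

(** Continuous induction takes the place of integration: the supremum of the times [s] with
    increment at most [(L + e) s] is itself such a time, and differentiability there would push it
    further unless it is 1. *)
Lemma mvt_curve (phi phi' : R -> W) (L : R) : (forall t : R, 0 <= t <= 1 -> nm (phi' t) <= L) ->
  (forall t : R, 0 <= t <= 1 -> forall e : R, 0 < e ->
    exists2 d : R, 0 < d & forall s : R, 0 <= s <= 1 ->
    `|s - t| < d -> nm (phi s - phi t - (s - t)%:C *: phi' t) <= e * `|s - t|) ->
  nm (phi 1 - phi 0) <= L.
Proof.
move=> phiL phid; apply/ler_addgt0Pr => e e0.
pose S := [set s | 0 <= s <= 1 /\ nm (phi s - phi 0) <= (L + e) * s].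
have S0 : S 0 by rewrite /S /= lexx ler01 subrr nm0 mulr0.
have hS : has_sup S by split; [exists 0 | exists 1 => s [/andP[]]].
pose t := sup S.
have t0 : 0 <= t by apply: sup_upper_bound.
have t1 : t <= 1 by apply: sup_le_ub; [exists 0 | move=> s [/andP[]]].
have t01 : 0 <= t <= 1 by rewrite t0.
have L0 : 0 <= L := le_trans (nm_ge0 _) (phiL _ t01).
have [d d0 Hd] := phid t t01 e e0.
have step s : 0 <= s <= 1 -> `|s - t| < d -> nm (phi s - phi t) <= (L + e) * `|s - t|.
  move=> s01 sd.
  have -> : phi s - phi t = (phi s - phi t - (s - t)%:C *: phi' t) + (s - t)%:C *: phi' t.
    by rewrite subrK.
  apply: le_trans (nmD _ _) _; rewrite nmZ nm_real mulrDl addrC lerD ?Hd //.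
  by rewrite mulrC ler_wpM2r // phiL.
have St : nm (phi t - phi 0) <= (L + e) * t.
  have [s [/andP[s0 s1] Ss] ds] := sup_adherent d0 hS.
  have st : s <= t by apply: sup_upper_bound => //; split=> //; rewrite s0.
  have := step s; rewrite s0 s1 ler0_norm ?subr_le0 // => /(_ isT) st'.
  have := nm_tri (phi s) (phi t) (phi 0); rewrite [nm (phi t - phi s)]nmBC.
  have sd : - (s - t) < d by rewrite -/t in ds; lra.
  have := st' sd; move: Ss; rewrite opprB mulrBr.
  set A := nm _; set B := nm _; set D := nm _; set E := _ * t; set F := _ * s.
  by clear; lra.
have [t1'|t1'] := ltP t 1; last first.
  have tE : t = 1 by apply/eqP; rewrite eq_le t1.
  by move: St; rewrite tE mulr1.
pose s := t + Num.min (d / 2) (1 - t).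
have m0 : 0 < Num.min (d / 2) (1 - t) by rewrite lt_min; apply/andP; split; lra.
have s01 : 0 <= s <= 1.
  have : Num.min (d / 2) (1 - t) <= 1 - t by rewrite ge_min lexx orbT.
  by rewrite /s => ?; apply/andP; split; lra.
have sts : s - t = Num.min (d / 2) (1 - t) by rewrite /s addrC addKr.
have md : Num.min (d / 2) (1 - t) < d.
  have : Num.min (d / 2) (1 - t) <= d / 2 by rewrite ge_min lexx.
  by move=> ?; lra.
have Ss : S s.
  split=> //.
  have := step s s01; rewrite sts gtr0_norm // => /(_ md) st'.
  apply: le_trans (nm_tri (phi t) _ _) _.
  have -> : (L + e) * s = (L + e) * Num.min (d / 2) (1 - t) + (L + e) * t by rewrite /s; ring.
  exact: lerD.
have : s <= t by apply: sup_upper_bound.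
by rewrite /s; lra.
Qed.

Context {V : normedModType R[i]}.
Implicit Types (f : V -> W).

Lemma diff_curve f (x v : V) (t : R) : differentiable f (x + t%:C *: v) ->
  forall e : R, 0 < e -> exists2 d : R, 0 < d & forall s : R, `|s - t| < d ->
   nm (f (x + s%:C *: v) - f (x + t%:C *: v) - (s - t)%:C *: 'd f (x + t%:C *: v) v)
     <= e * `|s - t|.
Proof.
move=> df e e0; have v0 := nm_ge0 v.
have v1 : 0 < nm v + 1 by lra.
have [d d0 H] := diff_approx df (divr_gt0 e0 v1).
exists (d / (nm v + 1)); first exact: divr_gt0.
move=> s; rewrite ltr_pdivlMr // => sd.
have svd : nm ((s - t)%:C *: v) <= `|s - t| * (nm v + 1).
  by rewrite nmZ nm_real ler_wpM2l //; lra.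
have := H _ (le_lt_trans svd sd).
have -> : x + t%:C *: v + (s - t)%:C *: v = x + s%:C *: v.
  by rewrite -addrA -scalerDl -rmorphD [t + _]addrC subrK.
rewrite linearZ /= => /le_trans; apply.
rewrite -mulrA ler_wpM2l ?(ltW e0) // ler_pdivrMl // mulrC.
by [].
Qed.

Lemma mvt f (x v : V) (L : R) :
  (forall t : R, 0 <= t <= 1 -> differentiable f (x + t%:C *: v)) ->
  (forall t : R, 0 <= t <= 1 -> nm ('d f (x + t%:C *: v) v) <= L) ->
  nm (f (x + v) - f x) <= L.
Proof.
move=> df fL.
have := @mvt_curve (fun t => f (x + t%:C *: v)) (fun t => 'd f (x + t%:C *: v) v) L fL.
rewrite scale1r scale0r addr0; apply=> t t01 e e0.
by have [d d0 H] := diff_curve (df _ t01) e0; exists d => // s _; exact: H.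
Qed.

Lemma differentiable_line f (x v : V) (z : R[i]) : differentiable f (x + z *: v) ->
  differentiable (fun s : R[i] => f (x + s *: v)) z /\
  'd (fun s : R[i] => f (x + s *: v)) z 1 = 'd f (x + z *: v) v.
Proof.
move=> df; have v0 := nm_ge0 v; have v1 : 0 < nm v + 1 by lra.
have [|u|e e0|dl ->] := @diff_intro R R[i] W (fun s : R[i] => f (x + s *: v)) z
  (fun s => s *: 'd f (x + z *: v) v) (nm ('d f (x + z *: v) v)).
- by move=> a s t; rewrite scalerDl scalerA.
- by rewrite nmZ mulrC.
- have [d d0 H] := diff_approx df (divr_gt0 e0 v1).
  exists (d / (nm v + 1)); first exact: divr_gt0.
  move=> u; rewrite ltr_pdivlMr // => ud.
  have uv : nm (u *: v) <= nm u * (nm v + 1).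
    by rewrite nmZ ler_wpM2l ?nm_ge0 //; lra.
  have := H _ (le_lt_trans uv ud).
  have -> : x + z *: v + u *: v = x + (z + u) *: v by rewrite -addrA -scalerDl.
  rewrite linearZ /= => /le_trans; apply.
  by rewrite -mulrA ler_wpM2l ?(ltW e0) // ler_pdivrMl // mulrC.
- by rewrite scale1r.
Qed.

Definition cball (x : V) (r : R) := [set y | nm (y - x) <= r].

Lemma cauchy_dir f (x u : V) (r K : R) : 0 < r -> holo (cball x r) f ->
  (forall y, cball x r y -> nm (f y) <= K) -> nm ('d f x u) <= 16 * K / r * nm u.
Proof.
move=> r0 hf fK; have [->|u0] := eqVneq u 0; first by rewrite linear0 !nm0 mulr0.
have nu : 0 < nm u by rewrite nm_gt0.
(* Rescaling [u] to length [r] turns the complex line through [x] into the unit disc of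
   [cauchy1]. *)
pose v := (r / nm u)%:C *: u.
have rn : 0 <= r / nm u by rewrite ltW // divr_gt0.
have nv : nm v = r by rewrite nmZ nm_real ger0_norm // mulfVK // gt_eqF.
have bz (z : R[i]) : nm z <= 1 -> cball x r (x + z *: v).
  by move=> z1; rewrite /cball /= addrC addKr nmZ nv ler_piMl // ltW.
have dz (z : R[i]) (z1 : nm z <= 1) := @differentiable_line f x v z (hf _ (bz z z1)).
have := @cauchy1 R W (fun z => f (x + z *: v)) K (fun z z1 => (dz z z1).1)
  (fun z z1 => fK _ (bz z z1)).
have n10 : nm (0 : R[i]) <= 1 by rewrite nm0 ler01.
rewrite (dz 0 n10).2 scale0r addr0 linearZ /= nmZ nm_real ger0_norm //.
move=> H; have -> : 16 * K / r * nm u = 16 * K / (r / nm u) by rewrite invf_div mulrA mulrAC.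
by rewrite ler_pdivlMr ?divr_gt0 // mulrC.
Qed.

End MeanValue.

(** * Second-order estimates *)

Section SecondOrder.
Context {R : realType} {V W : normedModType R[i]}.
Implicit Types (f : V -> W).

Lemma diff_addE f g (x u : V) : differentiable f x -> differentiable g x ->
  'd (fun z => f z + g z) x u = 'd f x u + 'd g x u.
Proof. by move=> df dg; exact: (congr1 (fun l : V -> W => l u) (diffD df dg)). Qed.

Lemma diff_subE f g (x u : V) : differentiable f x -> differentiable g x ->
  'd (fun z => f z - g z) x u = 'd f x u - 'd g x u.
Proof. by move=> df dg; exact: (congr1 (fun l : V -> W => l u) (diffB df dg)). Qed.

Lemma diff_scaleE f k (x u : V) : differentiable f x ->
  'd (fun z => k *: f z) x u = k *: 'd f x u.
Proof. by move=> df; exact: (congr1 (fun l : V -> W => l u) (diffZ k df)). Qed.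

Lemma diff_shift f (x w : V) : differentiable f (x + w) ->
  differentiable (fun z => f (z + w)) x /\
  'd (fun z => f (z + w)) x = 'd f (x + w) :> (V -> W).
Proof.
move=> df; have [K K0 HK] := diff_bounded df.
apply: (@diff_intro _ _ _ _ _ _ K) => //; first exact: linearP.
move=> e e0; have [d d0 H] := diff_approx df e0; exists d => // u ud.
by rewrite [x + u + w]addrAC; exact: H.
Qed.

Lemma cball_sub (x y : V) (r s : R) : nm (y - x) + s <= r -> cball y s `<=` cball x r.
Proof.
move=> rs z zs; have := nm_tri y z x; rewrite /cball /= in zs *; lra.
Qed.

(** Cauchy's estimate is used twice: on balls of radius [r / 2] it bounds the increment
    [f (z + w) - f z] by [32 K / r * nm w], and on the ball of radius [r / 4] it bounds the
    differential of this increment. *)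
Lemma cauchy_diff_lip f (x w u : V) (r K : R) : 0 < r -> holo (cball x r) f ->
  (forall y, cball x r y -> nm (f y) <= K) -> nm w <= r / 4 ->
  nm ('d f (x + w) u - 'd f x u) <= 16 * 32 * 4 * K / r ^+ 2 * nm w * nm u.
Proof.
move=> r0 hf fK wr.
have in_r z : nm (z - x) <= r / 2 -> cball x r z by rewrite /cball /=; lra.
have d1 z : nm (z - x) <= r / 2 -> nm ('d f z w) <= 32 * K / r * nm w.
  move=> zr.
  have sub : cball z (r / 2) `<=` cball x r by apply: cball_sub; lra.
  have := @cauchy_dir R W V f z w (r / 2) K ltac:(lra)
    (fun y h => hf y (sub y h)) (fun y h => fK y (sub y h)).
  by have -> : 16 * K / (r / 2) = 32 * K / r by field; rewrite gt_eqF.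
pose F z := f (z + w) - f z.
have in4 z : cball x (r / 4) z -> forall t : R, 0 <= t <= 1 ->
    nm (z + t%:C *: w - x) <= r / 2.
  rewrite /cball /= => zr t /andP[t0 t1]; rewrite addrAC.
  apply: le_trans (nmD _ _) _; rewrite nmZ nm_real ger0_norm //.
  by have := nm_ge0 w => ?; have : t * nm w <= nm w by [rewrite ler_piMl]; lra.
have hF : holo (cball x (r / 4)) F.
  move=> z zr; have z0 := in4 z zr 0; have z1 := in4 z zr 1.
  rewrite scale0r addr0 lexx ler01 in z0; rewrite scale1r lexx ler01 in z1.
  apply: differentiableB; last exact/hf/in_r/z0.
  by have [] := diff_shift (hf _ (in_r _ (z1 isT))).
have FK z : cball x (r / 4) z -> nm (F z) <= 32 * K / r * nm w.
  move=> zr; apply: mvt => t t01; [apply: hf; apply: in_r | apply: d1]; exact: in4.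
have x4 : cball x (r / 4) x by rewrite /cball /= subrr nm0; lra.
have := @cauchy_dir R W V F x u (r / 4) _ ltac:(lra) hF FK.
have z0 := in4 x x4 0; have z1 := in4 x x4 1.
rewrite scale0r addr0 lexx ler01 in z0; rewrite scale1r lexx ler01 in z1.
have [s1 s2] := diff_shift (hf _ (in_r _ (z1 isT))).
have s3 : differentiable f x by exact/hf/in_r/z0.
have FE : nm ('d F x u) = nm ('d f (x + w) u - 'd f x u).
  congr nm; apply: (etrans (diff_subE u s1 s3)); congr (_ - _).
  exact: (congr1 (fun l : V -> W => l u) s2).
rewrite -FE.
congr (_ <= _ * _).
by field; rewrite gt_eqF.
Qed.

Let sub_linear_part (a b p q : W) (s t : R[i]) :
  a - s *: p - (b - t *: p) - (s - t) *: (q - p) = a - b - (s - t) *: q.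
Proof.
rewrite scalerBr [(s - t) *: p]scalerBl !opprB.
rewrite [LHS](AC (2*2*3) (1*4*7*(5*2)*(3*6)))%AC /=.
by rewrite !subrr !addr0.
Qed.

Lemma taylor2 f (x u : V) (r K : R) : 0 < r -> holo (cball x r) f ->
  (forall y, cball x r y -> nm (f y) <= K) -> nm u <= r / 4 ->
  nm (f (x + u) - f x - 'd f x u) <= 16 * 32 * 4 * K / r ^+ 2 * nm u ^+ 2.
Proof.
move=> r0 hf fK ur; set B := _ * nm u ^+ 2.
have tu (t : R) : 0 <= t <= 1 -> nm (t%:C *: u) <= nm u.
  move=> /andP[t0 t1]; rewrite nmZ nm_real ger0_norm //.
  by rewrite ler_piMl ?nm_ge0.
have dt (t : R) : 0 <= t <= 1 -> differentiable f (x + t%:C *: u).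
  move=> t01; apply: hf; rewrite /cball /= [x + _]addrC addrK.
  by have := tu t t01; lra.
pose phi t := f (x + t%:C *: u) - t%:C *: 'd f x u.
pose phi' t := 'd f (x + (t : R)%:C *: u) u - 'd f x u.
have := @mvt_curve R W phi phi' B.
rewrite {}/phi {}/phi' scale1r scale0r addr0 scale1r scale0r subr0.
rewrite addrAC; apply=> [t t01|t t01 e e0].
  apply: le_trans (cauchy_diff_lip u r0 hf fK (le_trans (tu t t01) ur)) _.
  have K0 : 0 <= K.
    by apply: le_trans (nm_ge0 (f x)) (fK x _); rewrite /cball /= subrr nm0 ltW.
  have c0 : 0 <= 16 * 32 * 4 * K / r ^+ 2 by rewrite divr_ge0 ?sqr_ge0 // mulr_ge0.
  rewrite /B; move: (16 * 32 * 4 * K / r ^+ 2) c0 => c c0.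
  by rewrite expr2 mulrA ler_wpM2r ?nm_ge0 // ler_wpM2l ?tu.
have [d d0 H] := diff_curve (dt t t01) e0; exists d => // s _ sd.
have := H s sd; congr (nm _ <= _).
by rewrite rmorphB sub_linear_part.
Qed.

(** Balls need not be compact in a normed module, so the bound is taken from the first-order
    expansion at [x]. *)
Lemma holo_bounded f (A : set V) (x : V) : open A -> holo A f -> A x ->
  exists r K : R, [/\ 0 < r, 0 <= K, cball x r `<=` A
    & forall y, cball x r y -> nm (f y) <= K].
Proof.
move=> oA hf Ax; have [r r0 rA] := open_nmP oA Ax.
have [d d0 H] := diff_approx (hf _ Ax) ltr01.
have [K K0 HK] := diff_bounded (hf _ Ax).
pose m := Num.min r d / 2.
have md0 : 0 < Num.min r d by rewrite lt_min r0.
have m0 : 0 < m by rewrite /m; lra.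
have mr : m < r by have : Num.min r d <= r by [rewrite ge_min lexx]; rewrite /m; lra.
have md : m < d.
  by have : Num.min r d <= d by [rewrite ge_min lexx orbT]; rewrite /m; lra.
exists m, (nm (f x) + (1 + K) * m); split => //.
- by rewrite addr_ge0 ?nm_ge0 // mulr_ge0 //; lra.
- by move=> y ym; apply: rA; apply: le_lt_trans mr.
- move=> y ym; have xy : x + (y - x) = y by rewrite addrC subrK.
  have Hy := H (y - x) (le_lt_trans ym md); rewrite xy mul1r in Hy.
  have Hd := HK (y - x).
  have E : f y = f x + ('d f x (y - x) + (f y - f x - 'd f x (y - x))).
    by rewrite [_ + (_ - _ - _)]addrC subrK addrC subrK.
  rewrite E; apply: le_trans (nmD _ _) _; rewrite lerD2l.
  apply: le_trans (nmD _ _) _; rewrite mulrDl mul1r addrC.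
  apply: lerD; first exact: le_trans Hy ym.
  by apply: le_trans Hd _; rewrite ler_wpM2l // ltW.
Qed.

End SecondOrder.

(** * Derivatives of derivatives and their symmetry *)

Section SecondDerivative.
Context {R : realType} {V W : normedModType R[i]}.
Implicit Types (f : V -> W).

Let nm_pert (a b c a' b' c' : W) :
  nm (a - b - c) <= nm (a' - b' - c') + nm (a' - a) + nm (b' - b) + nm (c' - c).
Proof.
have E : a - b - c = (a' - b' - c') - (a' - a) + (b' - b) + (c' - c).
  rewrite opprB [RHS](AC (3*2*2*2) ((4*7*9)*(1*5)*(6*2)*(8*3)))%AC /=.
  by rewrite !subrr !addr0.
rewrite E; apply: le_trans (nmD _ _) _; rewrite lerD2r.
by apply: le_trans (nmD _ _) _; rewrite lerD2r nmB.
Qed.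

Let nm_tri_sym (a b c : W) : nm (a - b) <= nm (c - a) + nm (c - b).
Proof. by rewrite [nm (c - a)]nmBC; exact: nm_tri. Qed.

Let geo_le (a b c : R) : (forall k, a <= b + c * 2^-1 ^+ k) -> a <= b.
Proof.
move=> H; apply/ler_addgt0Pr => e e0; have [k ke] := geo_small c e0.
by apply: le_trans (H k) _; rewrite lerD2l ltW.
Qed.

(* The difference quotients of f along v converge uniformly, at a geometric rate,
   to z |-> 'd f z v; by Cauchy's estimate so do their differentials. *)
Lemma second_derivative f (A : set V) (x v : V) : geo_complete W ->
  open A -> holo A f -> A x ->
  differentiable (fun z => 'd f z v) x /\
  forall u, exists c tau : R, 0 < tau /\ forall k,
    nm ((tau * 2^-1 ^+ k)^-1%:C *:
        ('d f (x + (tau * 2^-1 ^+ k)%:C *: v) u - 'd f x u)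
        - 'd (fun z => 'd f z v) x u) <= c * 2^-1 ^+ k.
Proof.
move=> gW oA hf Ax.
have [r [K [r0 K0 rA fK]]] := holo_bounded oA hf Ax.
have {}hf : holo (cball x r) f by move=> y /rA /hf.
have v0 := nm_ge0 v.
have v1 : 0 < nm v + 1 by lra.
(* Every step [tau 2^-k v] has length at most [r / 16], within the reach of [taylor2] on balls of
   radius [r / 2]. *)
pose tau := (r / 16) / (nm v + 1).
have tau0 : 0 < tau by rewrite divr_gt0 //; lra.
have tauv : tau * nm v <= r / 16.
  by rewrite /tau mulrAC ler_pdivrMr // ler_wpM2l //; lra.
pose h k : R := 2^-1 ^+ k.
have h0 k : 0 < h k by rewrite exprn_gt0 // invr_gt0.
have h1 k : h k <= 1 by rewrite exprn_ile1 // ?invr_ge0 ?ler0n // invf_le1 ?ler1n.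
have hS k : h k.+1 <= h k by rewrite /h exprS; have := h0 k; rewrite /h; lra.
pose t k := tau * h k.
have t0 k : 0 < t k by rewrite mulr_gt0.
have tt k : t k <= tau by rewrite /t ler_piMr // ltW.
have tv k : nm ((t k)%:C *: v) <= r / 16.
  by rewrite nmZ nm_real gtr0_norm //; apply: le_trans tauv; rewrite ler_wpM2r.
pose D z := 'd f z v.
pose fk k z := (t k)^-1%:C *: (f (z + (t k)%:C *: v) - f z).
have sub2 z : cball x (r / 2) z -> cball z (r / 2) `<=` cball x r.
  by move=> zr; apply: cball_sub; rewrite /cball /= in zr; lra.
have [c1 [c10 a0]] : exists c1, 0 <= c1 /\ forall k z, cball x (r / 2) z ->
    nm (f (z + (t k)%:C *: v) - f z - (t k)%:C *: D z) <= c1 * (t k * t k).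
  exists (16 * 32 * 4 * K / (r / 2) ^+ 2 * nm v ^+ 2); split.
    by rewrite mulr_ge0 ?sqr_ge0 // divr_ge0 ?sqr_ge0 // mulr_ge0.
  move=> k z zr; rewrite -linearZ /=.
  have := @taylor2 R V W f z ((t k)%:C *: v) (r / 2) K ltac:(lra)
    (fun y yz => hf y (sub2 z zr y yz)) (fun y yz => fK y (sub2 z zr y yz)).
  have -> : r / 2 / 4 = r / 8 by field.
  have tv8 : nm ((t k)%:C *: v) <= r / 8 by apply: le_trans (tv k) _; lra.
  move=> /(_ tv8) /le_trans; apply.
  rewrite nmZ nm_real gtr0_norm //.
  move: (_ / _ ^+ 2) (t k) (nm v) => c p q.
  by have -> : c * (p * q) ^+ 2 = c * q ^+ 2 * (p * p) by ring.
have a1 k z : cball x (r / 2) z -> nm (fk k z - D z) <= c1 * tau * h k.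
  move=> zr.
  have tn : (t k)^-1%:C * (t k)%:C = 1 by rewrite -rmorphM mulVf ?gt_eqF.
  have -> : fk k z - D z =
      (t k)^-1%:C *: (f (z + (t k)%:C *: v) - f z - (t k)%:C *: D z).
    by rewrite scalerBr [_ *: (_ *: D z)]scalerA tn scale1r.
  rewrite nmZ nm_real gtr0_norm ?invr_gt0 // ler_pdivrMl // -mulrA -/(t k).
  by apply: le_trans (a0 k z zr) _; rewrite mulrCA.
have sub4 z : cball x (r / 4) z -> cball x (r / 2) z.
  by rewrite /cball /=; lra.
have hfs k z : cball x (r / 4) z -> differentiable f (z + (t k)%:C *: v).
  move=> zr; apply: hf; have := tv k; rewrite /cball /= in zr *.
  by have := nmD (z - x) ((t k)%:C *: v); rewrite [z - x + _]addrAC; lra.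
have hf0 z : cball x (r / 4) z -> differentiable f z.
  by move=> zr; apply: hf; rewrite /cball /= in zr *; lra.
have dfk k z : cball x (r / 4) z -> differentiable (fk k) z /\
    forall u, 'd (fk k) z u = (t k)^-1%:C *: ('d f (z + (t k)%:C *: v) u - 'd f z u).
  move=> zr; have [s1 s2] := diff_shift (hfs k z zr).
  have s3 := differentiableB s1 (hf0 z zr).
  split; first exact: differentiableZ.
  move=> u; apply: (etrans (diff_scaleE _ _ s3)); congr (_ *: _).
  apply: (etrans (diff_subE u s1 (hf0 z zr))); congr (_ - _).
  exact: (congr1 (fun l : V -> W => l u) s2).
have r40 : 0 < r / 4 by lra.
have x4 : cball x (r / 4) x by rewrite /cball /= subrr nm0 ltW.
pose c2 := 2 * c1 * tau.
have c20 : 0 <= c2 by rewrite mulr_ge0 ?(ltW tau0) ?mulr_ge0.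
pose c3 := 16 * c2 / (r / 4).
have c30 : 0 <= c3 by apply: divr_ge0; [exact: mulr_ge0 | exact: ltW].
(* Successive quotients differ by [O(2^-k)] on a whole ball; Cauchy's estimate passes this rate on
   to their differentials at [x], and [geo_complete] then supplies the limit [L u]. *)
have a4 u k : nm ('d (fk k.+1) x u - 'd (fk k) x u) <= c3 * nm u * 2^-1 ^+ k.
  have hF : holo (cball x (r / 4)) (fun z => fk k.+1 z - fk k z).
    by move=> z zr; apply: differentiableB; [exact: (dfk k.+1 z zr).1 | exact: (dfk k z zr).1].
  have FB z : cball x (r / 4) z -> nm (fk k.+1 z - fk k z) <= c2 * h k.
    move=> /sub4 zr; apply: le_trans (nm_tri (D z) _ _) _.
    have := a1 k z zr; have := a1 k.+1 z zr; rewrite [nm (D z - _)]nmBC.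
    have := ler_wpM2l (mulr_ge0 c10 (ltW tau0)) (hS k).
    rewrite /c2; have -> : 2 * c1 * tau * h k = c1 * tau * h k + c1 * tau * h k by ring.
    move: (c1 * tau * h k) (c1 * tau * h k.+1) (nm _) (nm _) => p q p' q'; clear; lra.
  have := cauchy_dir u r40 hF FB.
  rewrite [X in _ -> nm X <= _](_ : _ = 'd (fun z => fk k.+1 z - fk k z) x u); last first.
    exact: (esym (diff_subE u (dfk k.+1 x x4).1 (dfk k x x4).1)).
  move=> /le_trans; apply; rewrite /c3 -/(h k).
  have -> // : 16 * (c2 * h k) / (r / 4) * nm u = 16 * c2 / (r / 4) * nm u * h k.
  by move: (r / 4)^-1 => q; ring.
have [L LP] : exists L : V -> W, forall u k,
    nm ('d (fk k) x u - L u) <= 4 * (c3 * nm u) * 2^-1 ^+ k.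
  have ex u : exists l, forall k, nm ('d (fk k) x u - l) <= 4 * (c3 * nm u) * 2^-1 ^+ k.
    exact: (gW (fun k => 'd (fk k) x u) (c3 * nm u) (a4 u)).
  by have [L HL] := choice ex; exists L.
have linL : linear L.
  move=> a u w; apply/eqP; rewrite -subr_eq0; apply/eqP; apply: nm_small => e e0.
  suff : nm (L (a *: u + w) - (a *: L u + L w)) <= 0 by move=> /le_trans; apply; exact: ltW.
  pose c := 4 * (c3 * nm (a *: u + w)) + nm a * (4 * (c3 * nm u)) + 4 * (c3 * nm w).
  apply: (@geo_le _ _ c) => k; rewrite add0r.
  have E : L (a *: u + w) - (a *: L u + L w) =
      (a *: ('d (fk k) x u - L u) + ('d (fk k) x w - L w))
      - ('d (fk k) x (a *: u + w) - L (a *: u + w)).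
    rewrite (linearP ('d (fk k) x)) scalerBr opprB [X in _ = X + _]addrACA -opprD.
    by rewrite [RHS]addrC addrA subrK.
  rewrite E; apply: le_trans (nmB _ _) _.
  apply: le_trans (lerD (nmD _ _) (LP _ k)) _; rewrite nmZ.
  have H1 := ler_wpM2l (nm_ge0 a) (LP u k); have H2 := LP w k.
  apply: le_trans (lerD (lerD H1 H2) (lexx _)) _.
  rewrite /c; move: (2^-1 ^+ k) (c3 * _) (c3 * _) (c3 * _) (nm a) => p q q' q'' a'.
  by rewrite le_eqVlt; apply/orP; left; apply/eqP; ring.
have fkB k z : cball x (r / 4) z -> nm (fk k z) <= 16 * K / (r / 2) * nm v + c1 * tau.
  move=> /sub4 zr; rewrite -[fk k z](subrK (D z)).
  apply: le_trans (nmD _ _) _; rewrite addrC lerD //.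
    have r20 : 0 < r / 2 by lra.
    exact: (cauchy_dir v r20 (fun y yz => hf y (sub2 z zr y yz)) (fun y yz => fK y (sub2 z zr y yz))).
  apply: le_trans (a1 k z zr) _; rewrite ler_piMr ?h1 // mulr_ge0 //.
  exact: ltW.
move: (16 * K / (r / 2) * nm v + c1 * tau) fkB => K3 fkB.
have K30 : 0 <= K3 := le_trans (nm_ge0 _) (fkB 0%N x x4).
have [c4 [c40 T4]] : exists c4, 0 <= c4 /\ forall k u, nm u <= r / 16 ->
    nm (fk k (x + u) - fk k x - 'd (fk k) x u) <= c4 * nm u ^+ 2.
  exists (16 * 32 * 4 * K3 / (r / 4) ^+ 2); split.
    by apply: divr_ge0; [rewrite mulr_ge0 | exact: sqr_ge0].
  move=> k u ur; apply: (taylor2 r40 (fun z zr => (dfk k z zr).1) (fkB k)).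
  by apply: le_trans ur _; lra.
(* Pass to the limit in the Taylor estimate of [fk k], whose constant [c4] does not depend on
   [k]. *)
have main u : nm u <= r / 16 -> nm (D (x + u) - D x - L u) <= c4 * nm u ^+ 2.
  move=> ur; apply: (@geo_le _ _ (2 * (c1 * tau) + 4 * (c3 * nm u))) => k.
  have x2 : cball x (r / 2) x by apply: sub4.
  have xu2 : cball x (r / 2) (x + u) by rewrite /cball /= addrC addKr; lra.
  apply: le_trans (nm_pert _ _ _ (fk k (x + u)) (fk k x) ('d (fk k) x u)) _.
  apply: le_trans (lerD (lerD (lerD (T4 k u ur) (a1 k _ xu2)) (a1 k _ x2)) (LP u k)) _.
  rewrite -/(h k) -!addrA lerD2l.
  move: (c1 * tau) (c3 * nm u) (h k) => p q s.
  by rewrite le_eqVlt; apply/orP; left; apply/eqP; ring.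
have LB u : nm (L u) <= (16 * K3 / (r / 4) + 4 * c3) * nm u.
  have := LP u 0%N; rewrite expr0 mulr1 => l0.
  have c0 := cauchy_dir u r40 (fun z zr => (dfk 0%N z zr).1) (fkB 0%N).
  have := nmB ('d (fk 0%N) x u) ('d (fk 0%N) x u - L u); rewrite subKr => /le_trans; apply.
  by rewrite mulrDl -[4 * c3 * _]mulrA; exact: lerD.
have [|dD DE] := diff_intro linL LB (f := D) (x := x).
  move=> e e0; exists (Num.min (r / 16) (e / (c4 + 1))).
    by rewrite lt_min divr_gt0 //= ?divr_gt0 //; lra.
  move=> u; rewrite lt_min => /andP[ur ue].
  apply: le_trans (main u (ltW ur)) _; rewrite expr2 mulrA ler_wpM2r ?nm_ge0 //.
  rewrite ltr_pdivlMr in ue; last by lra.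
  rewrite mulrC; apply: le_trans (ltW ue); rewrite ler_wpM2l ?nm_ge0 //; lra.
split=> // u; exists (4 * (c3 * nm u)), tau; split=> // k.
have := LP u k; congr (nm (_ - _) <= _); first exact: ((dfk k x x4).2 u).
exact: (esym (congr1 (fun l : V -> W => l u) DE)).
Qed.

Lemma holo_diff f (A : set V) (v : V) : geo_complete W -> open A -> holo A f ->
  holo A (fun z => 'd f z v).
Proof. by move=> gW oA hf x Ax; have [] := second_derivative v gW oA hf Ax. Qed.

(** By [second_derivative] the left-hand side is a limit of difference quotients of ['d f _ u] along
    [v]; since ['d f _ u] is differentiable, the same quotients tend to the right-hand side. *)
Lemma diff_symmetric f (A : set V) (x u v : V) : geo_complete W -> open A -> holo A f ->
  A x -> 'd (fun z => 'd f z v) x u = 'd (fun z => 'd f z u) x v.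
Proof.
move=> gW oA hf Ax; apply/eqP; rewrite -subr_eq0; apply/eqP; apply: nm_small => e e0.
have [_ /(_ u) [c [tau [tau0 H]]]] := second_derivative v gW oA hf Ax.
have dG : differentiable (fun z => 'd f z u) x := holo_diff u gW oA hf Ax.
have v1 : 0 < nm v + 1 by have := nm_ge0 v; lra.
have e2 : 0 < e / 2 by lra.
have [d d0 Hd] := diff_approx dG (divr_gt0 e2 v1).
have tv0 : 0 < tau * (nm v + 1) by rewrite mulr_gt0.
have [k Hk] := geo_small (`|c| * d + tau * (nm v + 1) * (e / 2)) (mulr_gt0 e2 d0).
have {H} := H k; have h0 : (0 : R) < 2^-1 ^+ k by rewrite exprn_gt0 // invr_gt0.
move: (2^-1 ^+ k) h0 Hk => h h0; rewrite mulrDl => Hk.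
have p1 : 0 <= `|c| * d * h by rewrite !mulr_ge0 // ltW.
have p2 : 0 <= tau * (nm v + 1) * (e / 2) * h.
  by rewrite mulr_ge0 ?(ltW h0) // mulr_ge0 ?(ltW e2) // ltW.
have H1 : c * h <= e / 2.
  apply: le_trans (_ : `|c| * h <= _); first by rewrite ler_wpM2r ?ler_norm // ltW.
  rewrite -(ler_pM2r d0) mulrAC; apply: ltW; apply: le_lt_trans Hk.
  by rewrite lerDl.
have H2 : tau * (nm v + 1) * h < d.
  rewrite -(ltr_pM2r e2) mulrAC [d * _]mulrC; apply: le_lt_trans Hk.
  by rewrite lerDr.
have t0 : 0 < tau * h by rewrite mulr_gt0.
move: (tau * h) t0 (mulrAC tau (nm v + 1) h) => t t0 tE.
have tn : nm (t%:C *: v) = t * nm v by rewrite nmZ nm_real gtr0_norm.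
have tvd : nm (t%:C *: v) < d.
  rewrite tn; apply: le_lt_trans H2; rewrite tE.
  by rewrite ler_wpM2l ?(ltW t0) // lerDl.
move=> HX; have := Hd _ tvd; set q := 'd f _ u - _ in HX * => HY; clearbody q.
have {}HY : nm (t^-1%:C *: q - 'd (fun z => 'd f z u) x v) <= e / 2.
  have tK : t^-1%:C * t%:C = 1 by rewrite -rmorphM mulVf ?gt_eqF.
  have E : t^-1%:C *: q - 'd (fun z => 'd f z u) x v
      = t^-1%:C *: (q - 'd (fun z => 'd f z u) x (t%:C *: v)).
    rewrite scalerBr; congr (_ - _).
    rewrite (linearZ_LR ('d (fun z => 'd f z u) x)) /= scalerA.
    by rewrite tK scale1r.
  apply: (le_trans (y := t^-1 * (e / 2 / (nm v + 1) * (t * nm v)))).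
    rewrite (congr1 (@nm R W) E) nmZ nm_real gtr0_norm ?invr_gt0 //.
    rewrite ler_wpM2l ?invr_ge0 ?(ltW t0) //; apply: (le_trans HY); by rewrite tn.
  rewrite mulrCA mulKf ?gt_eqF // mulrAC ler_pdivrMr // ler_wpM2l ?(ltW e2) // lerDl.
  exact: ler01.
have S := lerD (le_trans HX H1) HY; rewrite -splitr in S; apply: le_trans _ S.
exact: nm_tri_sym.
Qed.

End SecondDerivative.

(** * Sup norms and completeness of row vectors and pairs *)

Section FiniteDimensional.
Context {R : realType}.
Notation C := R[i].

Lemma nm_ball (V : normedModType C) (x y : V) (e : R) : ball x e%:C y <-> nm (x - y) < e.
Proof. by rewrite -ball_normE /ball_ /= nmE ltcR. Qed.

Lemma nm_rV_lt n (x y : 'rV[C]_n) (e : R) : 0 < e ->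
  (nm (x - y) < e) <-> (forall j, nm (x 0 j - y 0 j) < e).
Proof.
move=> e0; rewrite -nm_ball; split=> [[_ xy] j|xy].
  by have := xy 0 j; rewrite nm_ball.
by split; [rewrite (ltcR 0) | move=> k j; apply/nm_ball; rewrite ord1].
Qed.

Lemma nm_pair_lt (V W : normedModType C) (x y : V * W) (e : R) :
  (nm (x - y) < e) <-> (nm (x.1 - y.1) < e /\ nm (x.2 - y.2) < e).
Proof.
split=> [/nm_ball [/nm_ball h1 /nm_ball h2] //|[h1 h2]].
by apply/nm_ball; split; apply/nm_ball.
Qed.

Lemma geo_rV n : geo_complete 'rV[C]_n.
Proof.
move=> a K aK.
have h0 k : (0 : R) < 2^-1 ^+ k by rewrite exprn_gt0 // invr_gt0.
have lim j : exists l, forall k, nm (a k 0 j - l) <= 4 * K * 2^-1 ^+ k.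
  apply: geo_complex => k; apply/ler_addgt0Pr => e e0.
  have Ke : nm (a k.+1 - a k) < K * 2^-1 ^+ k + e by apply: le_lt_trans (aK k) _; rewrite ltrDl.
  have Ke0 : 0 < K * 2^-1 ^+ k + e := le_lt_trans (nm_ge0 _) Ke.
  by apply: ltW; move/(nm_rV_lt _ _ Ke0): Ke.
have [l lP] := choice lim.
exists (\row_j l j) => k; apply/ler_addgt0Pr => e e0.
have K0 : 0 <= K by rewrite -(pmulr_lge0 _ (h0 0%N)); apply: le_trans (aK 0%N); exact: nm_ge0.
have Ke0 : 0 < 4 * K * 2^-1 ^+ k + e.
  by rewrite ltr_wpDl // mulr_ge0 ?(ltW (h0 k)) // mulr_ge0.
apply: ltW; apply/(nm_rV_lt _ _ Ke0) => j; rewrite mxE.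
by apply: le_lt_trans (lP j k) _; rewrite ltrDl.
Qed.

Lemma geo_pair (V W : normedModType C) : geo_complete V -> geo_complete W ->
  geo_complete (V * W)%type.
Proof.
move=> gV gW a K aK.
have aa k : nm ((a k.+1).1 - (a k).1) <= K * 2^-1 ^+ k /\
    nm ((a k.+1).2 - (a k).2) <= K * 2^-1 ^+ k.
  by split; apply/ler_addgt0Pr => e e0; apply: ltW;
    have /nm_pair_lt [? ?] : nm (a k.+1 - a k) < K * 2^-1 ^+ k + e
      by apply: le_lt_trans (aK k) _; rewrite ltrDl.
have [l lP] := gV (fun k => (a k).1) K (fun k => (aa k).1).
have [m mP] := gW (fun k => (a k).2) K (fun k => (aa k).2).
exists (l, m) => k; apply/ler_addgt0Pr => e e0; apply: ltW; apply/nm_pair_lt => /=.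
by split; [apply: le_lt_trans (lP k) _ | apply: le_lt_trans (mP k) _]; rewrite ltrDl.
Qed.

End FiniteDimensional.

(** * Lie derivatives of holomorphic functions *)

Section Leibniz.
Context {R : realType} {V W : normedModType R[i]}.
Implicit Types (f : V -> W) (F G : V -> V).

Let linear_comb (l0 l1 : {linear V -> W}) (m : {linear V -> V}) :
  linear (fun u => l1 u + l0 (m u)).
Proof. by move=> a u v; rewrite !linearP scalerDr addrACA. Qed.

Let product_remainder (l0 l1 : {linear V -> W}) (p q t : V) (s : W) :
  l1 p - l0 q - (s + l0 t) =
  (l1 q - l0 q - s) + l0 (p - q - t) + (l1 (p - q) - l0 (p - q)).
Proof.
rewrite !(linearB l0) !(linearB l1) opprD opprB.
rewrite [RHS](AC (3*3*(2*2)) ((7*2*3*6)*(1*8)*(4*10)*(9*5)))%AC /=.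
by rewrite !subrr !addr0 addrA.
Qed.

(** The remainder splits into three: that of ['d f _ (F x)], that of [F] under ['d f x], and a mixed
    term, quadratic because ['d f] is Lipschitz by [cauchy_diff_lip]. *)
Lemma diff_deriv_along f F (A : set V) (x : V) : geo_complete W -> open A ->
  holo A f -> holo A F -> A x ->
  differentiable (deriv_along F f) x /\
  forall u, 'd (deriv_along F f) x u
    = 'd (fun z => 'd f z (F x)) x u + 'd f x ('d F x u).
Proof.
move=> gW oA hf hF Ax.
have dD : differentiable (fun z => 'd f z (F x)) x := holo_diff (F x) gW oA hf Ax.
have [K1 K10 HK1] := diff_bounded dD.
have [K2 K20 HK2] := diff_bounded (hF _ Ax).
have [K3 K30 HK3] := diff_bounded (hf _ Ax).
have [r [K [r0 K0 rA fK]]] := holo_bounded oA hf Ax.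
have hfr : holo (cball x r) f by move=> y /rA /hf.
have [|u|e e0|dL LE] := @diff_intro R V W (deriv_along F f) x
  (fun u => 'd (fun z => 'd f z (F x)) x u + 'd f x ('d F x u)) (K1 + K3 * K2).
- exact: linear_comb.
- apply: le_trans (nmD _ _) _; rewrite mulrDl -mulrA; apply: lerD; first exact: HK1.
  apply: le_trans (HK3 _) _; exact: (ler_wpM2l (ltW K30) (HK2 u)).
- have e3 : 0 < e / 3 by lra.
  have [d1 d10 H1] := diff_approx dD e3.
  have [d2 d20 H2] := diff_approx (hF _ Ax) (divr_gt0 e3 K30).
  have [d3 d30 H3] := diff_approx (hF _ Ax) ltr01.
  have [c [c0 H4]] : exists c : R, 0 <= c /\ forall w u, nm w <= r / 4 ->
      nm ('d f (x + w) u - 'd f x u) <= c * nm w * nm u.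
    exists (16 * 32 * 4 * K / r ^+ 2); split.
      by apply: divr_ge0; [rewrite mulr_ge0 | exact: sqr_ge0].
    by move=> w u; exact: cauchy_diff_lip.
  have q0 : 0 < c * (K2 + 1) + 1 by rewrite ltr_wpDl // mulr_ge0 //; lra.
  pose d4 := Num.min (r / 4) (e / 3 / (c * (K2 + 1) + 1)).
  have d40 : 0 < d4 by rewrite lt_min !divr_gt0.
  exists (Num.min (Num.min d1 d2) (Num.min d3 d4)).
    by rewrite lt_min lt_min d10 d20 lt_min d30 d40.
  move=> u; rewrite !lt_min => /andP[/andP[u1 u2] /andP[u3 /andP[u4 u5]]].
  have E := product_remainder ('d f x) ('d f (x + u)) (F (x + u)) (F x) ('d F x u)
    ('d (fun z => 'd f z (F x)) x u).
  apply: (le_trans (y := e / 3 * nm u + e / 3 * nm u + e / 3 * nm u)); last first.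
    by move: (nm u) => p; have -> : e / 3 * p + e / 3 * p + e / 3 * p = e * p by field.
  apply: (le_trans (y := _)).
    by rewrite le_eqVlt; apply/orP; left; apply/eqP; exact: (congr1 (@nm R W) E).
  apply: le_trans (nmD _ _) _; apply: lerD.
    apply: le_trans (nmD _ _) _; apply: lerD; first exact: H1.
    apply: le_trans (HK3 _) _; apply: le_trans (ler_wpM2l (ltW K30) (H2 _ u2)) _.
    by rewrite mulrA mulrCA mulfV ?gt_eqF // mulr1.
  apply: le_trans (H4 _ _ (ltW u4)) _.
  have F1 : nm (F (x + u) - F x) <= (K2 + 1) * nm u.
    have := nmD (F (x + u) - F x - 'd F x u) ('d F x u); rewrite subrK => /le_trans; apply.
    by rewrite mulrDl addrC lerD ?HK2 ?H3.
  apply: le_trans (ler_wpM2l (mulr_ge0 c0 (nm_ge0 u)) F1) _.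
  have -> : c * nm u * ((K2 + 1) * nm u) = (nm u * (c * (K2 + 1))) * nm u by ring.
  rewrite ler_wpM2r ?nm_ge0 //; move: u5; rewrite ltr_pdivlMr // => /ltW; apply: le_trans.
  by rewrite ler_wpM2l ?nm_ge0 // lerDl.
split=> // u; exact: (congr1 (fun l : V -> W => l u) LE).
Qed.

Let leibniz_alg (l : {linear V -> W}) (a b : V) (s t : W) :
  s = t -> l (a - b) + (t + l b) = s + l a.
Proof. by move=> ->; rewrite (linearB l) addrCA subrK. Qed.

Lemma holo_deriv_along f F (A : set V) : geo_complete W -> open A ->
  holo A f -> holo A F -> holo A (deriv_along F f).
Proof. by move=> gW oA hf hF x Ax; have [] := diff_deriv_along gW oA hf hF Ax. Qed.

(** Expanding both iterated derivatives, the second differentials agree by symmetry and the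
    first-order terms combine to the bracket. *)
Lemma leibniz f F G (A : set V) (x : V) : geo_complete W -> open A ->
  holo A f -> holo A F -> holo A G -> A x ->
  deriv_along G (deriv_along F f) x =
  deriv_along (bracket G F) f x + deriv_along F (deriv_along G f) x.
Proof.
move=> gW oA hf hF hG Ax.
have [_ EF] := diff_deriv_along gW oA hf hF Ax.
have [_ EG] := diff_deriv_along gW oA hf hG Ax.
have S := diff_symmetric (G x) (F x) gW oA hf Ax.
apply: (etrans (EF _)); apply: esym.
apply: (etrans (congr1 (fun y => 'd f x (bracket G F x) + y) (EG _))).
exact: (leibniz_alg ('d f x) ('d F x (G x)) ('d G x (F x)) S).
Qed.

End Leibniz.

Lemma holo_bracket (R : realType) (V : normedModType R[i]) (X Y : V -> V) (A : set V) :
  geo_complete V -> open A -> holo A X -> holo A Y -> holo A (bracket X Y).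
Proof.
move=> gV oA hX hY x Ax; apply: differentiableB.
  exact: (holo_deriv_along gV oA hY hX Ax).
exact: (holo_deriv_along gV oA hX hY Ax).
Qed.

(** * Exponentials of formal vector fields *)

Section Reindexing.
Context {U : zmodType}.
Implicit Types (a : nat -> nat -> U).

Lemma sum_triangle a m :
  \sum_(i < m.+1) \sum_(j < (m - i).+1) a i j = \sum_(k < m.+1) \sum_(i < k.+1) a i (k - i)%N.
Proof.
elim: m => [|m IH]; first by rewrite !big_ord1.
rewrite big_ord_recr /= subnn big_ord1 [RHS]big_ord_recr /= -IH.
rewrite [X in _ = _ + X]big_ord_recr /= subnn addrA; congr (_ + _).
rewrite -big_split /=; apply: eq_bigr => i _.
have im : (i <= m)%N by rewrite -ltnS.
by rewrite subSn // big_ord_recr.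
Qed.

Lemma sum_triangle_sym a m :
  \sum_(i < m.+1) \sum_(j < (m - i).+1) a i j = \sum_(j < m.+1) \sum_(i < (m - j).+1) a i j.
Proof.
rewrite sum_triangle (sum_triangle (fun j i => a i j)); apply: eq_bigr => k _.
rewrite (reindex_inj rev_ord_inj) /=; apply: eq_bigr => i _.
by rewrite subSS subKn // -ltnS.
Qed.

End Reindexing.

Section FormalExponential.
Context {R : realType} {V W : normedModType R[i]}.
Context (gV : geo_complete V) (gW : geo_complete W).
Context (A : set V) (oA : open A).
Implicit Types (f : nat -> V -> W) (F : nat -> V -> V).

Lemma diff_sumE (U : normedModType R[i]) n (f : nat -> V -> U) (x : V) :
  (forall i, (i < n)%N -> differentiable (f i) x) ->
  differentiable (\sum_(i < n) f i) x /\
  forall u, 'd (\sum_(i < n) f i) x u = \sum_(i < n) 'd (f i) x u.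
Proof.
elim: n => [|n IH] df.
  rewrite big_ord0; split; first exact: (@differentiable_cst _ _ _ 0).
  by move=> u; rewrite big_ord0; exact: (congr1 (fun l : V -> U => l u) (diff_cst 0 x)).
have [|d1 e1] := IH; first by move=> i i_n; apply: df; exact: ltnW.
have dn : differentiable (f n) x by apply: df.
rewrite big_ord_recr /=; split; first exact: differentiableD.
by move=> u; rewrite big_ord_recr /= -e1; exact: (diff_addE u d1 dn).
Qed.

(** Components are total functions about which nothing is known outside [A]; openness of [A] allows
    identities valid on [A] to be differentiated. *)
Lemma diff_eq_on (U : normedModType R[i]) (f f' : V -> U) (x : V) : A x ->
  differentiable f x -> (forall z, A z -> f z = f' z) ->
  differentiable f' x /\ 'd f' x = 'd f x :> (V -> U).
Proof.
move=> Ax df ff'; have [K K0 HK] := diff_bounded df.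
have [r r0 rA] := open_nmP oA Ax.
apply: (@diff_intro _ _ _ _ _ _ K) => //; first exact: linearP.
move=> e e0; have [d d0 H] := diff_approx df e0.
exists (Num.min d r); first by rewrite lt_min d0.
move=> u; rewrite lt_min => /andP[ud ur]; rewrite -!ff' //; first exact: H.
by apply: rA; rewrite [x + u]addrC addrK.
Qed.

Definition hser (U : normedModType R[i]) (f : nat -> V -> U) := forall m, holo A (f m).

Definition eqser (U : normedModType R[i]) (f f' : nat -> V -> U) :=
  forall m x, A x -> f m x = f' m x.

Notation act := (@deriv_along R V W).
Notation pair := (fact_series act).

Lemma hser_pair F f : hser F -> hser f -> hser (pair F f).
Proof.
move=> hF hf m x Ax.
have [] := @diff_sumE W m.+1 (fun j => act (F j) (f (m - j)%N)) x _ => // j _.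
exact: (holo_deriv_along gW oA (hf _) (hF _) Ax).
Qed.

Notation Lie := (fact_series (@bracket R V)).

Lemma hser_Lie g F : hser g -> hser F -> hser (Lie g F).
Proof.
move=> hg hF m x Ax.
have [] := @diff_sumE V m.+1 (fun j => bracket (g j) (F (m - j)%N)) x _ => // j _.
exact: (holo_bracket gV oA (hg _) (hF _) Ax).
Qed.

(* fact_series of deriv_along, written pair, also contracts a series of fields with
   a series of functions; the action of g is the special case F = g. *)
Lemma pairE F f m x : pair F f m x = \sum_(j < m.+1) 'd (f (m - j)%N) x (F j x).
Proof. by rewrite /fact_series fct_sumE. Qed.

Lemma LieE g F m x : Lie g F m x = \sum_(j < m.+1) bracket (g j) (F (m - j)%N) x.
Proof. by rewrite /fact_series fct_sumE. Qed.

Lemma eq_pair F F' f f' : hser f -> eqser F F' -> eqser f f' -> eqser (pair F f) (pair F' f').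
Proof.
move=> hf FF ff m x Ax; rewrite !pairE; apply: eq_bigr => j _.
rewrite -(FF _ _ Ax); have [_ E] := diff_eq_on Ax (hf (m - j)%N x Ax) (ff (m - j)%N).
exact: (esym (congr1 (fun l : V -> W => l (F j x)) E)).
Qed.

Context (g : nat -> V -> V) (hg : hser g).

(** All three terms are brought to sums over [i + j <= m], with [f] taken at the index [m - i - j];
    the identity then holds summand by summand. *)
Lemma pair_leibniz F f : hser F -> hser f -> forall m x, A x ->
  pair g (pair F f) m x = pair (Lie g F) f m x + pair F (pair g f) m x.
Proof.
move=> hF hf m x Ax.
pose a i j := act (g i) (act (F j) (f (m - i - j)%N)) x.
pose b i j := act (bracket (g i) (F j)) (f (m - i - j)%N) x.
pose c i j := act (F j) (act (g i) (f (m - i - j)%N)) x.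
have -> : pair g (pair F f) m x = \sum_(i < m.+1) \sum_(j < (m - i).+1) a i j.
  rewrite pairE; apply: eq_bigr => i _.
  have [|_ E] := @diff_sumE W (m - i).+1 (fun j => act (F j) (f (m - i - j)%N)) x.
    by move=> j _; exact: (holo_deriv_along gW oA (hf _) (hF _) Ax).
  exact: E.
have -> : pair (Lie g F) f m x = \sum_(i < m.+1) \sum_(j < (m - i).+1) b i j.
  rewrite sum_triangle pairE; apply: eq_bigr => k _.
  rewrite LieE linear_sum; apply: eq_bigr => i _.
  have ik : (i <= k)%N by rewrite -ltnS.
  by rewrite /b -subnDA subnKC.
have -> : pair F (pair g f) m x = \sum_(i < m.+1) \sum_(j < (m - i).+1) c i j.
  rewrite sum_triangle_sym pairE; apply: eq_bigr => j _.
  have [|_ E] := @diff_sumE W (m - j).+1 (fun i => act (g i) (f (m - j - i)%N)) x.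
    by move=> i _; exact: (holo_deriv_along gW oA (hf _) (hg _) Ax).
  apply: (etrans (E _)); apply: eq_bigr => i _; rewrite /c subnAC; exact: erefl.
rewrite -big_split /=; apply: eq_bigr => i _.
rewrite -big_split /=; apply: eq_bigr => j _.
exact: (leibniz gW oA (hf _) (hF _) (hg _) Ax).
Qed.

End FormalExponential.

Lemma pascal_sum (U : zmodType) (b : nat -> nat -> U) k :
  \sum_(j < k.+1) b j.+1 (k - j)%N *+ 'C(k, j) + \sum_(j < k.+1) b j (k - j).+1 *+ 'C(k, j)
  = \sum_(j < k.+2) b j (k.+1 - j)%N *+ 'C(k.+1, j).
Proof.
rewrite [RHS]big_ord_recl /= bin0 mulr1n subn0.
rewrite [X in _ + X = _]big_ord_recl /= bin0 mulr1n subn0 addrCA; congr (_ + _).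
rewrite [RHS](eq_bigr (fun j : 'I_k.+1 => b j.+1 (k - j)%N *+ 'C(k, j)
    + b j.+1 (k - j)%N *+ 'C(k, j.+1))); last first.
  by move=> j _; rewrite /bump /= add1n subSS binS mulrnDr addrC.
rewrite big_split /=; congr (_ + _).
rewrite [RHS]big_ord_recr /= bin_small // mulr0n addr0.
apply: eq_bigr => j _; rewrite /bump /= add1n.
by rewrite -subSn // subSS.
Qed.

Section FormalExponential2.
Context {R : realType} {V W : normedModType R[i]}.
Context (gV : geo_complete V) (gW : geo_complete W).
Context (A : set V) (oA : open A).
Context (g : nat -> V -> V) (hg : hser A g) (g0 : forall x, A x -> g 0%N x = 0).
Implicit Types (f : nat -> V -> W) (F : nat -> V -> V).

Notation T := (fact_series (@deriv_along R V W) g).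
Notation L := (fact_series (@bracket R V) g).
Notation pair := (fact_series (@deriv_along R V W)).

Lemma hser_iterT f k : hser A f -> hser A (iter k T f).
Proof. by move=> hf; elim: k => [|k IH]; [exact: hf | exact: hser_pair]. Qed.

Lemma eq_iterT f f' k : hser A f -> eqser A f f' -> eqser A (iter k T f) (iter k T f').
Proof.
move=> hf ff; elim: k => [|k IH]; first exact: ff.
exact: (eq_pair oA (hser_iterT k hf) (fun _ _ _ => erefl) IH).
Qed.

Lemma pairD F f f' : hser A f -> hser A f' ->
  eqser A (pair F (fun m => f m + f' m)) (fun m => pair F f m + pair F f' m).
Proof.
move=> hf hf' m x Ax; rewrite pairE; apply: esym.
apply: (etrans (congr2 +%R (pairE _ _ _ _) (pairE _ _ _ _))).
rewrite -big_split /=; apply: eq_bigr => j _.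
exact: (esym (diff_addE (F j x) (hf _ _ Ax) (hf' _ _ Ax))).
Qed.

Lemma hserD (U : normedModType R[i]) (f f' : nat -> V -> U) :
  hser A f -> hser A f' -> hser A (fun m => f m + f' m).
Proof. by move=> hf hf' m x Ax; apply: differentiableD; [exact: hf | exact: hf']. Qed.

Lemma iterTD f f' k : hser A f -> hser A f' ->
  eqser A (iter k T (fun m => f m + f' m)) (fun m => iter k T f m + iter k T f' m).
Proof.
move=> hf hf'; elim: k => [|k IH] m x Ax; first exact: erefl.
have h := hser_iterT k (hserD hf hf').
apply: (etrans (eq_pair oA h (F := g) (fun _ _ _ => erefl) IH _ Ax)).
exact: (pairD _ (hser_iterT k hf) (hser_iterT k hf') _ Ax).
Qed.

(** The binomial formula for powers of a derivation, with [L] acting on the fields and [T] on the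
    functions. *)
Lemma iter_pair k F f m x : hser A F -> hser A f -> A x ->
  iter k T (pair F f) m x =
  \sum_(j < k.+1) pair (iter j L F) (iter (k - j) T f) m x *+ 'C(k, j).
Proof.
move=> hF hf Ax; elim: k F f hF hf => [|k IH] F f hF hf.
  by rewrite big_ord1 /= bin0 mulr1n.
have hLF := hser_Lie gV oA hg hF; have hTf := hser_pair gW oA hg hf.
have hP := hser_pair gW oA hF hf.
(* The innermost derivation is peeled off, so that Leibniz yields two contractions to which the
   hypothesis, stated for all [F] and [f], applies. *)
rewrite iterSr.
apply: (etrans (eq_iterT k (hser_pair gW oA hg hP)
  (fun m x Ax => pair_leibniz gW oA hg hF hf m Ax) _ Ax)).
apply: (etrans (iterTD k (hser_pair gW oA hLF hf) (hser_pair gW oA hF hTf) _ Ax)).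
apply: (etrans (congr2 +%R (IH _ _ hLF hf) (IH _ _ hF hTf))).
apply: etrans (pascal_sum (fun j l => pair (iter j L F) (iter l T f) m x) k).
apply: (congr2 +%R); apply: eq_bigr => j _.
  exact: (congr1 (fun G => pair G (iter (k - j) T f) m x *+ 'C(k, j)) (esym (iterSr j L F))).
exact: (congr1 (fun h => pair (iter j L F) h m x *+ 'C(k, j)) (esym (iterSr (k - j) T f))).
Qed.

Lemma diff_zero_on (U : normedModType R[i]) (f : V -> U) (x u : V) : A x ->
  (forall z, A z -> f z = 0) -> 'd f x u = 0.
Proof.
move=> Ax f0.
have [_ E] := @diff_eq_on R V A oA U (cst 0) f x Ax (differentiable_cst _ _)
  (fun z Az => esym (f0 z Az)).
apply: (etrans (congr1 (fun l : V -> U => l u) E)).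
exact: (congr1 (fun l : V -> U => l u) (diff_cst 0 x)).
Qed.

(** As [g] has no constant term, every application raises the order in eps by at least one. *)
Lemma iterT_small f l p x : (p < l)%N -> A x -> iter l T f p x = 0.
Proof.
elim: l p x => // l IH p x pl Ax /=.
rewrite pairE big1 // => -[[|j] jp] _ /=.
  by rewrite g0 // linear0.
by apply: diff_zero_on Ax _ => z Az; apply: IH Az; lia.
Qed.

Let sub00 (U : zmodType) (a b : U) : a = 0 -> b = 0 -> a - b = 0.
Proof. by move=> -> ->; rewrite subr0. Qed.

Lemma bracket_eq0l (X Y : V -> V) (x : V) : A x -> (forall z, A z -> X z = 0) ->
  bracket X Y x = 0.
Proof.
move=> Ax X0; apply: sub00; last exact: (diff_zero_on _ Ax).
exact: (etrans (congr1 ('d Y x) (X0 _ Ax)) (linear0 _)).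
Qed.

Lemma bracket_eq0r (X Y : V -> V) (x : V) : A x -> (forall z, A z -> Y z = 0) ->
  bracket X Y x = 0.
Proof.
move=> Ax Y0; apply: sub00; first exact: (diff_zero_on _ Ax).
exact: (etrans (congr1 ('d X x) (Y0 _ Ax)) (linear0 _)).
Qed.

Lemma iterL_small F l p x : (p < l)%N -> A x -> iter l L F p x = 0.
Proof.
elim: l p x => // l IH p x pl Ax /=.
rewrite LieE big1 // => -[[|j] jp] _ /=.
  exact: (bracket_eq0l _ Ax g0).
have s z : A z -> iter l L F (p - j.+1)%N z = 0 by move=> Az; apply: IH Az; lia.
exact: (bracket_eq0r _ Ax s).
Qed.

Let ifact k : R[i] := (k`!%:R)^-1.

(** The terms added up to [m] vanish by [iterT_small]; a common range of summation lets the sums be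
    exchanged later. *)
Lemma expT_E f p m x : hser A f -> (p <= m)%N -> A x ->
  forall u, 'd (exp_series (@deriv_along R V W) g f p) x u =
  \sum_(l < m.+1) ifact l *: 'd (iter l T f p) x u.
Proof.
move=> hf pm Ax u.
have dl l : differentiable (iter l T f p) x by exact: (hser_iterT l hf).
have [|_ E] := @diff_sumE R V W p.+1 (fun l => ifact l *: iter l T f p) x.
  by move=> l _; exact: differentiableZ.
apply: (etrans (E u)).
rewrite (big_ord_widen m.+1 (fun l => 'd (ifact l *: iter l T f p) x u)); last by lia.
rewrite big_mkcond /=; apply: eq_bigr => l _; case: ifP => lp.
  exact: (diff_scaleE (ifact l) u (dl l)).
have lp' : (p < l)%N by rewrite ltnNge -ltnS lp.
have z0 z : A z -> iter l T f p z = 0 by exact: iterT_small.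
by rewrite (diff_zero_on u Ax z0) scaler0.
Qed.

Lemma expL_E F p m x : (p <= m)%N -> A x ->
  exp_series (@bracket R V) g F p x = \sum_(l < m.+1) ifact l *: iter l L F p x.
Proof.
move=> pm Ax; rewrite /exp_series fct_sumE.
rewrite (big_ord_widen m.+1 (fun l => ((ifact l *: iter l L F p) : V -> V) x)); last by lia.
rewrite big_mkcond /=; apply: eq_bigr => l _; case: ifP => lp; first exact: erefl.
have lp' : (p < l)%N by rewrite ltnNge -ltnS lp.
by rewrite (iterL_small _ lp' Ax) scaler0.
Qed.

(* e^g (F f) = (e^{L_g} F) (e^g f), in the case F f = 0. *)
Lemma exp_pair0 F f m x : hser A F -> hser A f ->
  (forall p z, A z -> pair F f p z = 0) -> A x ->
  pair (exp_series (@bracket R V) g F) (exp_series (@deriv_along R V W) g f) m x = 0.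
Proof.
move=> hF hf pair0 Ax.
pose b j l := pair (iter j L F) (iter l T f) m x.
(* [iter j L F] begins at index [j] and [iter l T f] at index [l], so their contraction begins at
   [j + l]. *)
have b_small j l : (m < j + l)%N -> b j l = 0.
  move=> mjl; rewrite /b pairE big1 // => p _.
  have [pj|jp] := ltnP p j; first by rewrite (iterL_small _ pj Ax) linear0.
  have mpl : (m - p < l)%N by have := ltn_ord p; lia.
  by apply: diff_zero_on Ax _ => z Az; apply: iterT_small Az.
(* By [iter_pair] the sum is the [k]-th power of the derivation applied to [F f = 0]. *)
have b0 k : \sum_(j < k.+1) b j (k - j)%N *+ 'C(k, j) = 0.
  rewrite /b -(iter_pair k m hF hf Ax).
  apply: (etrans (eq_iterT (f' := fun _ _ => 0) k (hser_pair gW oA hF hf) pair0 _ Ax)).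
  elim: k m x Ax {b b_small} => [|k IH] m' x' Ax'; first exact: erefl.
  rewrite iterS.
  rewrite pairE big1 // => j _; apply: diff_zero_on Ax' _ => z Az; exact: IH.
have -> : pair (exp_series (@bracket R V) g F) (exp_series (@deriv_along R V W) g f) m x
    = \sum_(j < m.+1) \sum_(l < m.+1) (ifact j * ifact l) *: b j l.
  rewrite pairE.
  transitivity (\sum_(p < m.+1) \sum_(j < m.+1) \sum_(l < m.+1)
      (ifact j * ifact l) *: 'd (iter l T f (m - p)%N) x (iter j L F p x)).
    apply: eq_bigr => p _; have pm : (p <= m)%N by rewrite -ltnS.
    apply: (etrans (expT_E hf (leq_subr p m) Ax _)).
    rewrite (expL_E F pm Ax) [RHS]exchange_big /=; apply: eq_bigr => l _.
    rewrite linear_sum scaler_sumr; apply: eq_bigr => j _.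
    by rewrite linearZ /= scalerA mulrC.
  rewrite exchange_big /=; apply: eq_bigr => j _.
  rewrite exchange_big /=; apply: eq_bigr => l _.
  by rewrite /b pairE scaler_sumr.
transitivity (\sum_(j < m.+1) \sum_(l < (m - j).+1) (ifact j * ifact l) *: b j l).
  apply: eq_bigr => j _; have jm : (j <= m)%N by rewrite -ltnS.
  rewrite [RHS](big_ord_widen m.+1 (fun l => (ifact j * ifact l) *: b j l)); last by lia.
  rewrite [RHS]big_mkcond /=; apply: eq_bigr => l _; case: ifP => // lm.
  have ml : (m < j + l)%N by rewrite -ltn_subLR // ltnNge -ltnS lm.
  by rewrite (b_small _ _ ml) scaler0.
rewrite (sum_triangle (fun j l => (ifact j * ifact l) *: b j l)) big1 // => k _.
(* [1 / (j! (k - j)!)] is ['C(k, j) / k!], which gathers total degree [k] into the sum of [b0]. *)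
have E : \sum_(j < k.+1) ((ifact j * ifact (k - j)%N) *: b j (k - j)%N)
    = ifact k *: \sum_(j < k.+1) b j (k - j)%N *+ 'C(k, j).
  rewrite scaler_sumr; apply: eq_bigr => j _.
  rewrite -scaler_nat scalerA; congr (_ *: _).
  have jk : (j <= k)%N by rewrite -ltnS.
  rewrite /ifact -(bin_fact jk) !natrM !invfM.
  have c0 : ('C(k, j)%:R : R[i]) != 0 by rewrite pnatr_eq0 -lt0n bin_gt0.
  by rewrite [RHS]mulrAC mulVf // mul1r.
by rewrite E b0 scaler0.
Qed.

End FormalExponential2.

(** * Nagumo norms and the Borel transform *)

Section Nagumo.
Context {R : realType} {V1 V2 W : normedModType R[i]}.

Lemma nm_pair_le (x y : V1 * V2) (e : R) :
  (nm (x - y) <= e) <-> (nm (x.1 - y.1) <= e /\ nm (x.2 - y.2) <= e).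
Proof.
split=> [xy|[xy1 xy2]].
  by split; apply/ler_addgt0Pr => d d0; apply: ltW;
    have /nm_pair_lt [? ?] : nm (x - y) < e + d by apply: le_lt_trans xy _; rewrite ltrDl.
apply/ler_addgt0Pr => d d0; apply: ltW; apply/nm_pair_lt.
by split; [apply: le_lt_trans xy1 _ | apply: le_lt_trans xy2 _]; rewrite ltrDl.
Qed.

Context (h : V1 * V2 -> V2 -> V1 * V2) (x : nat -> V1 * V2 -> W).
Context (z0 : V1) (r a b : R).
Notation w0 := (z0, 0 : V2).
Context (xh : forall k, holo (cball w0 r) (x k)).
Context (xS : forall k w v, cball w0 r w -> 'd (x k.+1) w (0, v) = - 'd (x k) w (h w v)).
Context (x0 : forall k z, cball w0 r (z, 0) -> x k.+1 (z, 0) = 0).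
Context (xa : forall w, cball w0 r w -> nm (x 0%N w) <= a).
Context (b0 : 0 <= b) (hb : forall w v, cball w0 r w -> nm (h w v) <= b * nm v).

(* Nagumo's trick: losing the fraction 1/(k+2) of the distance r - s to the
   boundary in the Cauchy estimate of step k keeps the bound of the form k^k. *)
Lemma nagumo k s w : 0 <= s -> s < r -> cball w0 s w ->
  nm (x k w) <= a * (16 * (b * r) * k.+1%:R / (r - s)) ^+ k.
Proof.
elim: k s w => [|k IH] /= s w s0 sr ws.
  by rewrite expr0 mulr1; apply: xa; apply: le_trans ws (ltW sr).
have rs : 0 < r - s by lra.
have k2 : (0 : R) < k.+2%:R by [].
pose d := (r - s) / k.+2%:R.
have d0 : 0 < d by rewrite divr_gt0.
have drs : d < r - s.
  by rewrite /d ltr_pdivrMr // -[ltLHS]mulr1 ltr_pM2l // ltr1n.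
(* By the choice of [d], the base of the power is the same at step [k] on the larger ball as at step
   [k + 1] on the smaller one. *)
have E : k.+1%:R / (r - (s + d)) = k.+2%:R / (r - s).
  rewrite /d -(natr1 k.+1) in k2 *.
  have n1 : k.+1%:R + 1 != 0 :> R by rewrite gt_eqF.
  have n2 : r - s != 0 by rewrite gt_eqF.
  have n3 : (k.+1%:R : R) != 0 by rewrite pnatr_eq0.
  have -> : r - (s + (r - s) / (k.+1%:R + 1)) = (r - s) * k.+1%:R / (k.+1%:R + 1) by field.
  by field; rewrite n2 [1 + _]addrC natr1 n1 n3.
set M := a * (16 * (b * r) * k.+2%:R / (r - s)) ^+ k.
have IHd y : cball w0 (s + d) y -> nm (x k y) <= M.
  move=> yd; rewrite /M -[_ * k.+2%:R / _]mulrA -E mulrA; apply: IH yd; first by lra.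
  by lra.
have M0 : 0 <= M.
  apply: le_trans (nm_ge0 (x k w0)) (IHd w0 _); rewrite /cball /= subrr nm0; lra.
have xk : holo (cball w0 (s + d)) (x k).
  by move=> y yd; apply: xh; apply: le_trans yd _; lra.
(* The centre lies on the zero section and the norm is a maximum, so the ray from the zero section
   to [w] stays in the ball. *)
have in_s (t : R) : 0 <= t <= 1 -> cball w0 s ((w.1, 0) + t%:C *: (0, w.2)).
  move=> /andP[t0 t1]; have /nm_pair_le [/= w1 w2] := ws.
  apply/nm_pair_le => /=; rewrite scaler0 !addr0 add0r subr0; split=> //.
  rewrite subr0 in w2; rewrite nmZ nm_real ger0_norm //.
  by apply: le_trans w2; rewrite ler_piMl ?nm_ge0.
have in_r y : cball w0 s y -> cball w0 r y by move=> ys; apply: le_trans ys (ltW sr).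
have step y v : cball w0 s y -> nm v <= s -> nm ('d (x k.+1) y (0, v)) <= 16 * M / d * (b * r).
  move=> ys vs; rewrite (xS _ _ (in_r _ ys)) nmN.
  have sub : cball y d `<=` cball w0 (s + d).
    by move=> u ud; have := nm_tri y u w0; move: ys ud; rewrite /cball /=; lra.
  apply: le_trans (cauchy_dir _ d0 (fun u ud => xk u (sub u ud)) (fun u ud => IHd u (sub u ud))) _.
  apply: ler_wpM2l; first by apply: divr_ge0; [rewrite mulr_ge0 | exact: ltW].
  apply: le_trans (hb _ (in_r _ ys)) _; rewrite ler_wpM2l //; lra.
have -> : a * (16 * (b * r) * k.+2%:R / (r - s)) ^+ k.+1 = 16 * M / d * (b * r).
  rewrite exprSr mulrA -/M /d invf_div; move: (r - s)^-1 k.+2%:R => p q; ring.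
have /nm_pair_le [/= w1 w2] := ws; rewrite subr0 in w2.
have ww : (w.1, 0) + (0, w.2) = w.
  by case: (w) => w1' w2'; rewrite /= -[LHS]/(w1' + 0, 0 + w2') addr0 add0r.
have := @mvt R W _ (x k.+1) (w.1, 0) (0, w.2) (16 * M / d * (b * r)).
rewrite ww x0 ?subr0; last first.
  apply: in_r; have := in_s 0; rewrite scale0r addr0; apply; rewrite lexx; exact: ler01.
apply=> t t01; first by apply: xh; apply: in_r; exact: in_s.
exact: step (in_s _ t01) w2.
Qed.

End Nagumo.

(** [n^n] is at most the falling factorial [(2n)(2n - 1)...(n + 1) = 'C(2n, n) n!], and
    ['C(2n, n) <= 2^(2n)]. *)
Lemma exp_fact_bound n : (n ^ n <= 4 ^ n * n`!)%N.
Proof.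
have ff a k : (a ^ k <= (a + k) ^_ k)%N.
  elim: k => [|k IH]; first by rewrite expn0 ffactn0.
  by rewrite expnS addnS ffactSS leq_mul //; lia.
have bin2 m k : ('C(m, k) <= 2 ^ m)%N.
  have [km|mk] := leqP k m; last by rewrite bin_small.
  rewrite -[2%N]/(1 + 1)%N expnDn (bigD1 (inord k)) //= inordK //.
  by rewrite !exp1n !muln1; exact: leq_addr.
apply: leq_trans (ff n n) _.
by rewrite -bin_ffact leq_mul2r -[4%N]/(2 ^ 2)%N -expnM mul2n -addnn bin2 orbT.
Qed.

Section Borel.
Context {R : realType} {T : Type}.

(* With |x_k| <= a (q (k+1))^k, the k-th Borel coefficient is at most geometric
   because (k+1)^(k+1) <= 4^(k+1) (k+1)!. *)
Lemma borel_uniform (x : nat -> T -> R[i]) (A : set T) (a q : R) : 0 <= a -> 0 < q ->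
  (forall k p, A p -> nm (x k p) <= a * (q * k.+1%:R) ^+ k) ->
  exists2 rho : R, 0 < rho & exists B : T * R[i] -> R[i], exists K : R,
    forall N (p : T * R[i]), A p.1 -> nm p.2 < rho ->
      nm (\sum_(1 <= k < N.+1) x k p.1 / ((k.-1)`!%:R) * p.2 ^+ k.-1 - B p)
        <= K * 2^-1 ^+ N.
Proof.
move=> a0 q0 xa.
pose S N (p : T * R[i]) : R[i] := \sum_(1 <= k < N.+1) x k p.1 / ((k.-1)`!%:R) * p.2 ^+ k.-1.
have q8 : 0 < 8 * q by rewrite mulr_gt0.
have q16 : 0 < 16 * q by rewrite mulr_gt0.
(* The coefficients grow like [(8 q)^k], so this radius makes the increments decay with ratio
   1/2. *)
exists (16 * q)^-1; first by rewrite invr_gt0.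
have coef k p : A p -> nm (x k.+1 p) / k`!%:R <= 4 * a * (8 * q) ^+ k.+1.
  move=> Ap; rewrite ler_pdivrMr ?ltr0n ?fact_gt0 //.
  apply: le_trans (xa _ _ Ap) _; rewrite exprMn.
  (* [exp_fact_bound] at [k + 2], divided by [k + 2]; the remaining factor [k + 1] is then absorbed
     by [2^(k + 1)], which turns 4 into 8. *)
  have n1 : ((k.+2 ^ k.+1)%N <= 4 ^ k.+2 * (k.+1 * k`!))%N.
    rewrite -(leq_pmul2l (ltn0Sn k.+1)) -expnS mulnCA -factS -factS.
    exact: exp_fact_bound.
  have n2 : ((k.+2 ^ k.+1)%N <= 4 * 8 ^ k.+1 * k`!)%N.
    apply: leq_trans n1 _; rewrite expnS -[8%N]/(4 * 2)%N expnMn.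
    rewrite -[leqRHS]mulnA -!mulnA leq_mul // leq_mul // leq_mul //.
    exact: ltnW (ltn_expl _ _).
  rewrite -(ler_nat R) !natrM !natrX in n2.
  apply: le_trans (ler_wpM2l a0 (ler_wpM2l (exprn_ge0 k.+1 (ltW q0)) n2)) _.
  by rewrite exprMn le_eqVlt; apply/orP; left; apply/eqP; ring.
have inc N p : A p.1 -> nm p.2 < (16 * q)^-1 ->
    nm (S N.+1 p - S N p) <= 32 * a * q * 2^-1 ^+ N.
  move=> Ap px; rewrite /S big_nat_recr //= [X in nm X]addrAC subrr add0r !nmM nmV nm_nat nmX.
  have e1 : nm p.2 ^+ N <= ((16 * q)^-1) ^+ N by rewrite lerXn2r ?nnegrE ?nm_ge0 // ?invr_ge0 ltW.
  have e2 := coef N _ Ap.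
  apply: le_trans (ler_pM _ _ e2 e1) _; rewrite ?divr_ge0 ?exprn_ge0 ?nm_ge0 //.
  have -> : 4 * a * (8 * q) ^+ N.+1 * (16 * q)^-1 ^+ N
      = 32 * a * q * ((8 * q) * (16 * q)^-1) ^+ N.
    by rewrite exprS [X in _ = _ * X]exprMn; move: ((8 * q) ^+ N) (_ ^+ N) => u v; ring.
  have -> : 8 * q * (16 * q)^-1 = 2^-1 by field; rewrite gt_eqF.
  exact: lexx.
have ex (p : T * R[i]) : exists l, A p.1 -> nm p.2 < (16 * q)^-1 -> forall N,
    nm (S N p - l) <= 4 * (32 * a * q) * 2^-1 ^+ N.
  have [[Ap px]|nA] := pselect (A p.1 /\ nm p.2 < (16 * q)^-1); last first.
    by exists 0 => Ap px; case: nA.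
  by have [l lP] := geo_complex (fun N => inc N p Ap px); exists l.
have [B HB] := choice ex.
by exists B, (4 * (32 * a * q)) => N p Ap px; exact: HB.
Qed.

End Borel.

Lemma uniform_geo (R : realType) (T : choiceType) (F : nat -> T -> R[i]) (B : T -> R[i])
    (A : set T) (K : R) :
  (forall N p, A p -> nm (F N p - B p) <= K * 2^-1 ^+ N) -> {uniform A, F @ \oo --> B}.
Proof.
move=> FB P /uniform_nbhs [E [entE EP]].
move: entE; rewrite -entourage_ballE => -[e /= e0 eE].
have eE' : e = (complex.Re e)%:C.
  by move: e0; rewrite ltcE /= => /andP[/eqP + _]; case: (e) => ? ? /= ->.
have e0' : 0 < complex.Re e by move: e0; rewrite ltcE => /andP[].
have [k kK] := geo_small `|K| e0'.
exists k => // N /= kN; apply: EP => p Ap; apply: eE => /=.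
rewrite eE'; apply/nm_ball; rewrite nmBC; apply: le_lt_trans (FB N p Ap) _.
apply: le_lt_trans kK; have h0 m : (0 : R) <= 2^-1 ^+ m by rewrite exprn_ge0 // invr_ge0.
apply: le_trans (ler_wpM2r (h0 N) (ler_norm K)) _; rewrite ler_wpM2l //.
by rewrite ler_wiXn2l // ?invr_ge0 // invf_le1 // ler1n.
Qed.

(** * Flat Darboux coordinates *)

Section Chart.
Context {R : realType} {n : nat} (M : complex_manifold R n).
Notation C := R[i].
Notation E := (CV R n).
Notation TE := (TCV R n).
Context (c : chart R n M) (ac : atlas c).

Lemma open_img : open (img c).
Proof. by have [_ ? _ _ _] := atlas_chart ac. Qed.

Lemma open_Timg : open (Timg c).
Proof.
rewrite openE => w wU; apply/nearP.
have [d d0 dU] := open_nmP open_img wU; exists d => // y /nm_pair_lt [y1 _].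
exact: dU.
Qed.

Lemma geo_TE : geo_complete TE.
Proof. by apply: geo_pair; exact: geo_rV. Qed.

Lemma diff_bounded_linear (V W : normedModType C) (L : V -> W) (K : R) x : linear L ->
  (forall u, nm (L u) <= K * nm u) -> differentiable L x /\ 'd L x = L :> (V -> W).
Proof.
move=> linL LK; apply: (diff_intro linL LK) => e e0; exists 1 => // u _.
have -> : L (x + u) - L x - L u = 0.
  by have := linL 1 x u; rewrite !scale1r => ->; rewrite [X in X - _]addrAC subrr add0r subrr.
by rewrite nm0 mulr_ge0 ?nm_ge0 // ltW.
Qed.

Lemma nm_coord (u : E) j : nm (u 0 j) <= nm u.
Proof.
apply/ler_addgt0Pr => e e0; apply: ltW.
have ue : nm (u - 0) < nm u + e by rewrite subr0 ltrDl.
have ue0 : 0 < nm u + e := le_lt_trans (nm_ge0 _) ue.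
by move/(nm_rV_lt _ _ ue0): ue => /(_ j); rewrite mxE subr0.
Qed.

Lemma nm_fst (w : TE) : nm w.1 <= nm w.
Proof.
by have := (nm_pair_le w 0 (nm w)).1; rewrite subr0 !subr0 => /(_ (lexx _)) [].
Qed.

Lemma nm_snd (w : TE) : nm w.2 <= nm w.
Proof.
by have := (nm_pair_le w 0 (nm w)).1; rewrite subr0 !subr0 => /(_ (lexx _)) [].
Qed.

Lemma diff_x_st0 (i : 'I_n) (x : TE) :
  differentiable (x_st i 0 : TE -> C) x /\ forall u, 'd (x_st i 0 : TE -> C) x u = - u.1 0 i.
Proof.
have [|u|d e] := @diff_bounded_linear TE C (x_st i 0) 1 x.
- by move=> a u v; rewrite /= !mxE opprD -mulrN.
- by rewrite mul1r nmN; apply: le_trans (nm_coord _ _) (nm_fst _).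
- by split=> // u; exact: (congr1 (fun l : TE -> C => l u) e).
Qed.

Lemma diff_x_st1 (i : 'I_n) (x : TE) :
  differentiable (x_st i 1 : TE -> C) x /\ forall u, 'd (x_st i 1 : TE -> C) x u = u.2 0 i.
Proof.
have [|u|d e] := @diff_bounded_linear TE C (x_st i 1) 1 x.
- by move=> a u v; rewrite /= !mxE.
- by rewrite mul1r; apply: le_trans (nm_coord _ _) (nm_snd _).
- by split=> // u; exact: (congr1 (fun l : TE -> C => l u) e).
Qed.

Lemma diff_x_st2 (i : 'I_n) k (x : TE) :
  differentiable (x_st i k.+2 : TE -> C) x /\ forall u, 'd (x_st i k.+2 : TE -> C) x u = 0.
Proof.
split; first exact: (@differentiable_cst _ _ _ 0).
move=> u; exact: (congr1 (fun l : TE -> C => l u) (diff_cst 0 x)).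
Qed.

Lemma hser_x_st (i : 'I_n) : hser (Timg c) (x_st i : nat -> TE -> C).
Proof.
case=> [|[|k]] x _; [exact: (diff_x_st0 i x).1 | exact: (diff_x_st1 i x).1 |].
exact: (diff_x_st2 i k x).1.
Qed.

Lemma local_cst (X : E) : local_field c (img c) (fun _ => X).
Proof.
split; [exact: open_img | by [] | move=> z _; exact: differentiable_cst].
Qed.

(** For constant [X] and [Y] the derivative terms of [cov_form] vanish, and flatness of the [j]-th
    coordinate form leaves the [j]-th component of the Christoffel symbol. *)
Lemma flat_chart_Christoffel (Om : chart R n M -> E -> 'M[C]_n)
  (D : chart R n M -> E -> E -> E -> E) z X Y :
  flat_Darboux Om D c -> img c z -> D c z X Y = 0.
Proof.
move=> [_ H _] zc; apply/rowP => j; rewrite mxE.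
have := H j _ _ _ (local_cst X) (local_cst Y) z zc.
rewrite /cov_form /cov.
have d0 : 'd (fun _ : E => Y) z X = 0 by exact: (congr1 (fun l : E -> E => l X) (diff_cst Y z)).
have d1 : 'd ((fun _ => Y 0 j) : E -> C) z X = 0.
  exact: (congr1 (fun l : E -> C => l X) (diff_cst (Y 0 j) z)).
rewrite mxE => /eqP; rewrite subr_eq0 => /eqP e.
have := etrans (esym e) d1.
rewrite (_ : ('d (fun _ : E => Y) z X) 0 j = 0) ?add0r //.
by apply: (etrans (congr1 (fun u : E => u 0 j) d0)); rewrite mxE.
Qed.

End Chart.

(** * The twisted coordinates in a flat chart *)

Section FlatChart.
Context {R : realType} {n : nat} (M : complex_manifold R n).
Notation C := R[i].
Notation E := (CV R n).
Notation TE := (TCV R n).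
Context (D : chart R n M -> E -> E -> E -> E) (h : chart R n M -> TE -> E -> TE).
Context (g : nat -> chart R n M -> TE -> TE) (c : chart R n M) (i : 'I_n).
Context (ac : atlas c) (D0 : forall z X Y, img c z -> D c z X Y = 0).
Context (conD : connection (ehresmann D)) (conh : connection h).
Context (g_Lie : LieG g) (g_gauge : gauge_transforms g (ehresmann D) h).
Context (g_zero : vanishes_on_zero_section g).

Notation U := (Timg c).
Notation gc := (fun k => g k c).
Notation act := (@deriv_along R TE C).
Notation xt := (x_twisted g c i).

Lemma hser_g : hser U gc.
Proof. by move=> k; have [[+ _] _] := g_Lie.2 k; apply. Qed.

Lemma g_0 w : U w -> g 0%N c w = 0.
Proof. exact: g_Lie.1. Qed.

Lemma hser_relative (k : chart R n M -> TE -> E -> TE) X : connection k ->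
  hser U (relative_connection k c (fun _ => X)).
Proof.
move=> [_ _ hk _] [|[|m]] w Uw.
- exact: (@differentiable_cst _ _ _ ((0, X) : TE)).
- exact: hk.
- exact: (@differentiable_cst _ _ _ 0).
Qed.

(* The coordinates x_st are flat for the model connection. *)
Lemma pair_flat X m w : U w ->
  fact_series act (relative_connection (ehresmann D) c (fun _ => X)) (x_st i) m w = 0.
Proof.
move=> Uw; rewrite pairE.
(* The index [m] belongs to eps^(m-2). At [m = 1] the vertical derivative of theta^i cancels the
   horizontal derivative of -Z^i; at [m = 2] the vanishing of [D] is used. *)
case: m => [|[|[|m]]].
- rewrite big_ord1 /=; apply: (etrans ((diff_x_st0 i w).2 _)).
  by rewrite mxE oppr0.
- rewrite !big_ord_recl big_ord0 addr0.
  apply: (etrans (congr2 +%R ((diff_x_st1 i w).2 _) ((diff_x_st0 i w).2 _))).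
  by rewrite /= subrr.
- rewrite !big_ord_recl big_ord0 addr0.
  apply: (etrans (congr2 +%R ((diff_x_st2 i 0 w).2 _)
    (congr2 +%R ((diff_x_st1 i w).2 _) (linear0 _)))).
  by rewrite /= /hlift /ehresmann /= D0 // oppr0 mxE !addr0.
- apply: big1 => -[[|[|j]] jm] _.
  + exact: (diff_x_st2 i m.+1 w).2.
  + exact: (diff_x_st2 i m w).2.
  + exact: linear0.
Qed.

Lemma hser_xt : hser U xt.
Proof.
move=> m w Uw; have hf := hser_x_st (c:=c) i.
have [|d _] := @diff_sumE R TE C m.+1
  (fun k => (k`!%:R)^-1 *: iter k (fact_series act gc) (x_st i) m) w.
  move=> k _; apply: differentiableZ.
  exact: (hser_iterT (@geo_complex R) (open_Timg ac) hser_g k hf m).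
exact: d.
Qed.

(* The coefficient of eps^k in A_X x = 0. *)
Lemma xt_recursion k w X : U w ->
  'd (xt k.+1 : TE -> C) w (0, X) = - 'd (xt k : TE -> C) w (h c w X).
Proof.
move=> Uw.
have := exp_pair0 (@geo_TE R n) (@geo_complex R) (open_Timg ac) hser_g g_0 k.+1
  (hser_relative X conD) (hser_x_st (c:=c) i) (fun p z Uz => pair_flat X p Uz) Uw.
rewrite pairE.
(* A constant field over the whole chart realises any tangent vector; the gauge condition leaves
   only the indices 0 and 1, that is [v] and [h]. *)
have gg j := g_gauge ac (local_cst ac X) j Uw.
move=> H; apply/eqP; rewrite -addr_eq0; apply/eqP; apply: etrans _ H.
rewrite !big_ord_recl big1 ?addr0.
  apply: (congr2 +%R).
    exact: (esym (congr1 ('d (xt k.+1 : TE -> C) w) (gg 0%N))).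
  rewrite /bump /= subn1 /=.
  exact: (esym (congr1 ('d (xt k : TE -> C) w) (gg 1%N))).
move=> j _; apply: (etrans (congr1 ('d (xt (k.+1 - bump 0 (bump 0 j))%N : TE -> C) w) (gg _))).
exact: linear0.
Qed.

Lemma xt0 w : xt 0%N w = x_st i 0 w.
Proof. by rewrite /x_twisted /exp_series big_ord1 fact0 invr1 scale1r. Qed.

(** The only possible correction at eps^0 is [g 1] applied to -Z^i, and a vertical field annihilates
    functions of the base. *)
Lemma xt1 w : U w -> xt 1%N w = x_st i 1 w.
Proof.
move=> Uw; rewrite /x_twisted /exp_series fct_sumE !big_ord_recl big_ord0 addr0.
have z : fact_series act gc (x_st i) 1 w = 0.
  rewrite pairE !big_ord_recl big_ord0 addr0.
  apply: (etrans (congr2 +%R (congr1 ('d (x_st i 1 : TE -> C) w) (g_0 Uw))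
    ((diff_x_st0 i w).2 (g 1%N c w)))).
  by rewrite linear0 (g_Lie.2 1%N).2 // mxE oppr0 addr0.
rewrite -[RHS]addr0; apply: (congr2 +%R).
  by rewrite /= fact0 invr1 -[LHS]/(1 *: _) scale1r.
by rewrite -[LHS]/(_ *: fact_series act gc (x_st i) 1 w) z scaler0.
Qed.

(** Every term of the exponential with [k >= 1] ends with a derivative along some [g j], which is 0
    there; the term [k = 0] is theta^i or 0. *)
Lemma xt_zero m z : img c z -> xt m.+1 (z, 0) = 0.
Proof.
move=> zc; rewrite /x_twisted /exp_series fct_sumE; apply: big1 => -[[|k] km] _.
  rewrite -[LHS]/(_ *: x_st i m.+1 (z, 0)).
  by case: (m) => [|m']; rewrite /= ?mxE scaler0.
rewrite -[LHS]/(_ *: fact_series act gc (iter k (fact_series act gc) (x_st i)) m.+1 (z, 0)).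
rewrite pairE big1 ?scaler0 // => j _.
by apply: (etrans (congr1 ('d _ (z, 0)) (g_zero j ac zc))); exact: linear0.
Qed.

(** Linearity in the tangent vector reduces uniformity in [X] to the finitely many basis vectors,
    each giving a function bounded near [w0]. *)
Lemma h_bounded w0 : U w0 -> exists r b : R, [/\ 0 < r, 0 < b, cball w0 r `<=` U
  & forall w X, cball w0 r w -> nm (h c w X) <= b * nm X].
Proof.
move=> Uw0; have [linh _ hh _] := conh.
pose e j : E := delta_mx 0 j.
have B j : exists rK : R * R, [/\ 0 < rK.1, 0 <= rK.2, cball w0 rK.1 `<=` U
    & forall w, cball w0 rK.1 w -> nm (h c w (e j)) <= rK.2].
  by have [r [K ?]] := holo_bounded (open_Timg ac) (hh c (e j) ac) Uw0; exists (r, K).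
have [rK HrK] := choice B.
have [d d0 dU] := open_nmP (open_Timg ac) Uw0.
pose r := \big[Num.min/d / 2]_(j < n) (rK j).1.
have r0 : 0 < r by apply: lt_bigmin => [|j _]; [lra | by case: (HrK j)].
have rd : r <= d / 2 by exact: bigmin_le_id.
have rr j : r <= (rK j).1 by exact: bigmin_le_cond.
(* The summand 1 keeps the bound positive, also for [n = 0]. *)
exists r, (1 + \sum_(j < n) (rK j).2); split=> //.
- by rewrite ltr_pwDl // sumr_ge0 // => j _; case: (HrK j).
- by move=> w wr; apply: dU; move: wr; rewrite /cball /= => ?; lra.
move=> w X wr.
have Uw : U w by apply: dU; move: wr; rewrite /cball /= => ?; lra.
pose L := h c w.
have linL : linear L := linh c w ac Uw.
pose LM := GRing.isLinear.Build _ _ _ _ L linL.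
pose LL : {linear E -> TE} := HB.pack L LM.
have -> : h c w X = \sum_(j < n) X 0 j *: LL (e j).
  rewrite -[LHS]/(LL X) {1}(row_sum_delta X) linear_sum; apply: eq_bigr => j _.
  exact: linearZ.
apply: le_trans (nm_sum _ _ _) _; rewrite mulrDl mul1r mulr_suml.
apply: ler_wpDl; first exact: nm_ge0.
apply: ler_sum => j _; rewrite nmZ mulrC; apply: ler_pM; rewrite ?nm_ge0 ?nm_coord //.
by have [_ _ _] := HrK j; apply; apply: le_trans wr (rr j).
Qed.

End FlatChart.

Theorem theorem4p5 (R : realType) (n : nat) (M : complex_manifold R n)
    (Om : chart R n M -> CV R n -> 'M[R[i]]_n)
    (Gam : chart R n M -> CV R n -> set (CV R n))
    (D : chart R n M -> CV R n -> CV R n -> CV R n -> CV R n)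
    (Z : chart R n M -> CV R n -> CV R n)
    (h : chart R n M -> TCV R n -> CV R n -> TCV R n)
    (HJ : Joyce_structure Om Gam D Z h)
    (g : nat -> chart R n M -> TCV R n -> TCV R n)
    (g_Lie : LieG g)
    (g_gauge : gauge_transforms g (ehresmann D) h)
    (g_zero : vanishes_on_zero_section g)
    (c : chart R n M) (c_flat : flat_Darboux Om D c) (i : 'I_n) :
  ((forall m w, Timg c w -> (m <= 1)%N -> x_diff g c i m w = 0) /\
   (forall m, holo (Timg c) (x_diff g c i m))) /\
  (forall p0 : M, cdom c p0 ->
     exists r : R, [/\ 0 < r, polydisc (cmap c p0, 0) r `<=` Timg c
       & exists rho : R, 0 < rho /\
         exists B : TCV R n * R[i] -> R[i],
           {uniform [set q | polydisc (cmap c p0, 0) r q.1 /\ `|q.2| < rho%:C],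
             borel_partial (fun k => x_diff g c i k.+1) @ \oo --> B}]).
Proof.
have [ac _ _] := c_flat.
have D0 z X Y : img c z -> D c z X Y = 0 := @flat_chart_Christoffel R n M c ac Om D z X Y c_flat.
have [[_ conD] _ _] : lattice_connection Gam D by have [] := J_period HJ.
have conh : connection h by have [] := J_pre HJ.
have hx := hser_xt i ac g_Lie.
split; first split.
- move=> [|[|//]] w Uw _; rewrite /x_diff.
    by rewrite xt0 subrr.
  by rewrite (xt1 i ac g_Lie Uw) subrr.
- move=> m w Uw.
  have d1 : differentiable (x_twisted g c i m : TCV R n -> R[i]) w := hx m w Uw.
  have d2 : differentiable (x_st i m : TCV R n -> R[i]) w := hser_x_st (c:=c) i m Uw.
  exact: (differentiableB d1 d2).
move=> p0 cp0; set z0 := cmap c p0.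
have Uz0 : Timg c (z0, 0) by exists p0.
have [r [b [r0 b0 rU hb]]] := h_bounded ac conh Uz0.
have in_r z (zr : cball (z0, 0) r (z, 0)) : img c z := rU (z, 0) zr.
(* With this shift [x k] is the coefficient of eps^k, starting from [x 0 = theta^i]. *)
pose x k := x_twisted g c i k.+1.
have xh k : holo (cball (z0, 0) r) (x k) by move=> y yr; exact: hx k.+1 y (rU _ yr).
have xS k w v : cball (z0, 0) r w ->
    'd (x k.+1 : TCV R n -> R[i]) w (0, v) = - 'd (x k : TCV R n -> R[i]) w (h c w v).
  by move=> wr; exact: (xt_recursion i ac D0 conD g_Lie g_gauge k.+1 v (rU _ wr)).
have x0 k z : cball (z0, 0 : CV R n) r (z, 0) -> x k.+1 (z, 0) = 0.
  by move=> zr; exact: (xt_zero i ac g_zero k.+1 (in_r z zr)).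
have xa w : cball (z0, 0) r w -> nm (x 0%N w) <= r.
  move=> wr; rewrite /x (xt1 i ac g_Lie (rU _ wr)).
  have /nm_pair_le [_] := wr; rewrite /= subr0; apply: le_trans.
  exact: nm_coord.
(* The bound of [nagumo] blows up at the boundary; on half the radius it becomes [r (q (k + 1))^k]
   with a fixed [q]. *)
have r20 : 0 < r / 2 by rewrite divr_gt0.
have r2r : r / 2 < r by lra.
have bound k w (ws : cball (z0, 0) (r / 2) w) :=
  nagumo xh xS x0 xa (ltW b0) hb k (ltW r20) r2r ws.
have poly w : polydisc (z0, 0) (r / 2) w -> cball (z0, 0) (r / 2) w.
  move=> wp; apply/nm_pair_le.
  by split; apply: ltW; apply/(nm_rV_lt _ _ r20) => j; rewrite -ltcR -nmE;
    case: (wp j).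
exists (r / 2); split; first by rewrite divr_gt0.
  move=> w /poly wr; apply: rU; apply: le_trans wr _.
  by rewrite ler_pdivrMr // ler_pMr // ler1n.
pose q := 16 * (b * r) / (r / 2).
have q0 : 0 < q by rewrite divr_gt0 // mulr_gt0 // mulr_gt0.
have xq k w : polydisc (z0, 0) (r / 2) w -> nm (x k w) <= r * (q * k.+1%:R) ^+ k.
  move=> /poly ws; apply: le_trans (bound k w ws) _.
  have -> : r - r / 2 = r / 2 by field.
  by rewrite /q [16 * (b * r) / _ * _]mulrAC.
have [rho rho0 [B [K HB]]] := borel_uniform (ltW r0) q0 xq.
exists rho; split=> //; exists B; apply: (@uniform_geo _ _ _ _ _ K) => N p [pr].
rewrite nmE ltcR => prho; apply: le_trans (HB N p pr prho).
rewrite le_eqVlt; apply/orP; left; apply/eqP; congr (nm (_ - _)).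
(* The partial sums of [x] and of [x_diff] coincide, since they start at [k = 1] and [x_st] has no
   positive powers of eps. *)
rewrite /borel_partial big_nat_cond [RHS]big_nat_cond; apply: eq_bigr => k /andP[/andP[k1 _] _].
congr (_ / _ * _); rewrite /x /x_diff.
case: k k1 => // k _; exact: subr0.
Qed.
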